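(* Let $\lambda,\alpha\in\mathbb{R}$ with $\alpha\neq 0$, and let $\Phi\colon\Sigma\to\mathbb{R}^3$ be a $\lambda$-shrinker of the Gauss curvature flow (with constant $\alpha$). If the mean curvature $H$ of $\Sigma$ is constant, then $\Phi(\Sigma)$ is contained in a plane, a sphere or a circular cylinder.
   Context: Surfaces are smooth, connected, orientable, and immersed in Euclidean space $\mathbb{R}^3$ by an immersion $\Phi\colon\Sigma\to\mathbb{R}^3$, with a chosen smooth unit normal $N$ (Gauss map). The principal curvatures $\kappa_1,\kappa_2$ are the eigenvalues of the shape operator $SX=-\overline\nabla_X N$ ($\overline\nabla$ the flat connection of $\mathbb{R}^3$), $H=\frac{\kappa_1+\kappa_2}{2}$ is the mean curvature and $K=\kappa_1\kappa_2$ is the Gauss curvature. Completeness is not assumed. Given $\lambda\in\mathbb{R}$ and $\alpha\in\mathbb{R}$, $\alpha\ne 0$, the surface is a $\lambda$-shrinker of the Gauss curvature flow if $K=\alpha\langle N,\Phi\rangle+\lambda$ at every point of $\Sigma$, where $\Phi$ is regarded as the position vector. *)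

(* Defs.v *)
From HB Require Import structures.
From mathcomp Require Import all_boot all_order all_algebra.
From mathcomp Require Import all_classical all_reals all_analysis.
Set Implicit Arguments.
Unset Strict Implicit.
Unset Printing Implicit Defensive.
Import Order.TTheory GRing.Theory Num.Theory.
Import numFieldNormedType.Exports.
Local Open Scope classical_set_scope.
Local Open Scope ring_scope.

(* The library's norm on 'rV[R]_n is the sup norm (same topology and same
   differentials), hence a separate Euclidean inner product and norm. *)
Definition dot (R : realType) (n : nat) (u v : 'rV[R]_n) : R :=
  \sum_(i < n) u 0 i * v 0 i.

Definition enorm (R : realType) (n : nat) (u : 'rV[R]_n) : R :=
  Num.sqrt (dot u u).

(* Meant for an open set U. Differentiability at every point gives continuity,
   and C^(k+1) means: differentiable with C^k differential, the latter being
   tested on each fixed direction v. *)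
Fixpoint Ck_on (R : realType) (V W : normedModType R) (k : nat) (U : set V)
    (f : V -> W) : Prop :=
  match k with
  | 0 => forall x, U x -> {for x, continuous f}
  | k'.+1 => (forall x, U x -> differentiable f x) /\
             (forall v : V, Ck_on k' U ('D_v f))
  end.

Definition smooth_on (R : realType) (V W : normedModType R) (U : set V)
    (f : V -> W) : Prop := forall k, Ck_on k U f.

(* A homeomorphism from an open subset of T onto an open subset of R^2, with
   both directions totalized arbitrarily. *)
Record chart (R : realType) (T : topologicalType) := Chart {
  chart_dom : set T;
  chart_map : T -> 'rV[R]_2;
  chart_inv : 'rV[R]_2 -> T;
  chart_dom_open : open chart_dom;
  chart_cod_open : open (chart_map @` chart_dom);
  chart_mapK : forall p, chart_dom p -> chart_inv (chart_map p) = p;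
  chart_map_continuous :
    forall p, chart_dom p -> {for p, continuous chart_map};
  chart_inv_continuous :
    forall x, (chart_map @` chart_dom) x -> {for x, continuous chart_inv}
}.

Section Atlas.
Context (R : realType) (T : topologicalType).
Implicit Types (c : chart R T) (A B : set (chart R T)).

Definition chart_cod c : set 'rV[R]_2 := chart_map c @` chart_dom c.

Definition transition c1 c2 : 'rV[R]_2 -> 'rV[R]_2 :=
  chart_map c2 \o chart_inv c1.

Definition transition_dom c1 c2 : set 'rV[R]_2 :=
  chart_map c1 @` (chart_dom c1 `&` chart_dom c2).

Definition smooth_atlas A : Prop :=
  (forall p, exists2 c, A c & chart_dom c p) /\
  (forall c1 c2, A c1 -> A c2 ->
     smooth_on (transition_dom c1 c2) (transition c1 c2)).

Definition oriented_atlas A : Prop :=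
  smooth_atlas A /\
  (forall c1 c2 x, A c1 -> A c2 -> transition_dom c1 c2 x ->
     0 < \det ('J (transition c1 c2) x)).

Definition orientable_atlas A : Prop :=
  exists2 B, oriented_atlas B & smooth_atlas (A `|` B).

End Atlas.

Record surface (R : realType) := Surface {
  surface_space :> topologicalType;
  atlas : set (chart R surface_space);
  surface_hausdorff : hausdorff_space surface_space;
  surface_second_countable : @second_countable surface_space;
  surface_connected : connected [set: surface_space];
  surface_smooth : smooth_atlas atlas;
  surface_orientable : orientable_atlas atlas
}.

Section SurfaceTheory.
Context (R : realType) (Sigma : surface R).
Implicit Types (Phi N : Sigma -> 'rV[R]_3) (p : Sigma) (c : chart R Sigma).

(* Vectors are rows acted on from the right: X *m dmap f c p is the derivative
   of f at p along the tangent vector with coordinates X in the chart c. *)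
Definition dmap (n : nat) (f : Sigma -> 'rV[R]_n) c p : 'M[R]_(2, n) :=
  'J (f \o chart_inv c) (chart_map c p).

Definition smooth_map (n : nat) (f : Sigma -> 'rV[R]_n) : Prop :=
  forall c, atlas c -> smooth_on (chart_cod c) (f \o chart_inv c).

Definition immersion Phi : Prop :=
  smooth_map Phi /\
  (forall c p, atlas c -> chart_dom c p -> row_free (dmap Phi c p)).

Definition unit_normal Phi N : Prop :=
  [/\ smooth_map N,
      (forall p, enorm (N p) = 1) &
      (forall c p, atlas c -> chart_dom c p ->
         forall X : 'rV[R]_2, dot (X *m dmap Phi c p) (N p) = 0)].

(* The matrix, in the coordinate basis of c, of the endomorphism S of the
   tangent plane given by dPhi (S X) = - dN X. For a unit normal N along an
   immersion Phi, the rows of dmap N c p lie in the row space of the row-free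
   dmap Phi c p, so this is the unique matrix with
   shape_operator Phi N c p *m dmap Phi c p = - dmap N c p. *)
Definition shape_operator Phi N c p : 'M[R]_2 :=
  - (dmap N c p *m pinvmx (dmap Phi c p)).

(* In dimension 2 the set of eigenvalues determines their multiplicities: a
   single eigenvalue a stands for the pair (a, a). *)
Definition are_principal_curvatures Phi N p (k : R * R) : Prop :=
  forall c, atlas c -> chart_dom c p ->
  forall a : R, eigenvalue (shape_operator Phi N c p) a <-> a = k.1 \/ a = k.2.

(* Such a pair exists, and is unique up to order, because the shape operator is
   self-adjoint and its eigenvalues do not depend on the chart; the default
   value (0, 0) is never used for an immersion with a unit normal. *)
Definition principal_curvatures Phi N p : R * R :=
  xget (0, 0) [set k | are_principal_curvatures Phi N p k].

Definition mean_curvature Phi N p : R :=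
  ((principal_curvatures Phi N p).1 + (principal_curvatures Phi N p).2) / 2.

Definition gauss_curvature Phi N p : R :=
  (principal_curvatures Phi N p).1 * (principal_curvatures Phi N p).2.

Definition gauss_flow_shrinker (lambda alpha : R) Phi N : Prop :=
  forall p, gauss_curvature Phi N p = alpha * dot (N p) (Phi p) + lambda.

End SurfaceTheory.

Section Models.
Context (R : realType).
Implicit Type P : set 'rV[R]_3.

Definition is_plane P : Prop :=
  exists (v : 'rV[R]_3) (d : R), v != 0 /\ P = [set x | dot x v = d].

Definition is_sphere P : Prop :=
  exists (a : 'rV[R]_3) (r : R), 0 < r /\ P = [set x | enorm (x - a) = r].

(* The points at distance r from the line through a with unit direction u. *)
Definition is_circular_cylinder P : Prop :=
  exists (a u : 'rV[R]_3) (r : R), [/\ enorm u = 1, 0 < r &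
    P = [set x | enorm ((x - a) - dot (x - a) u *: u) = r]].

End Models.

(* Main.v *)
(* Write the principal curvatures as H + mu and H - mu, so that the shrinker
   equation reads H^2 - mu^2 = alpha h + lambda with h = <N, Phi>. Away from
   umbilics and from K = 0, work in an orthonormal principal frame (e1, e2) with
   m_i = e_i(mu). Codazzi expresses the connection coefficients through the m_i,
   and differentiating the shrinker equation once expresses the components of
   the tangent part of Phi. Differentiating it twice yields the second
   derivatives of mu, and Gauss's equation then becomes first order:
     2 (m1^2 + m2^2) = alpha H + K^2 - lambda (H^2 + mu^2).
   Differentiating this along e1 gives m1 * P(mu) = 0 with P a polynomial of
   degree 5, hence m1 = 0, and m2 = 0 by exchanging the roles of e1 and e2.
   So K and h are constant, which forces dN to be orthogonal to Phi. If K <> 0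
   then |Phi| is constant; if K = H = 0 then N is constant; if K = 0 <> H the
   kernel direction of dN is a constant vector, the axis of a cylinder. *)
Require Import Defs.
From mathcomp Require Import all_boot all_order all_algebra.
From mathcomp Require Import all_classical all_reals all_analysis.
From mathcomp Require Import ring lra.
Set Implicit Arguments.
Unset Strict Implicit.
Unset Printing Implicit Defensive.
Import Order.TTheory GRing.Theory Num.Theory.
Import numFieldNormedType.Exports.
Local Open Scope classical_set_scope.
Local Open Scope ring_scope.

(** * Derivative rules and smooth maps *)

(** Nothing is known about the size of the umbilic set or of the zero set of K, so the frame
    argument does not reach all points by density. Instead, on the open set where some derivative of
    K is nonzero, it forces K (K - H^2) = 0; differentiating this twice in the same direction makes
    that derivative vanish. The quintic is disposed of in the same spirit: a polynomial that
    vanishes along mu, where mu has a nonzero derivative, vanishes with all its derivatives, whereas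
    the leading coefficient of P is 6 for all values of H, alpha and lambda. The frame comes from
    linear algebra: for a fixed row u, Cayley-Hamilton makes u (S - k2) an eigenvector for k1, and
    it is nonzero near a point for a suitable u. Local conclusions become global because Sigma is
    connected. The axis of the cylinder is determined only up to sign, so the object that is
    propagated is the orthogonal projection onto it. Since dN is orthogonal to Phi itself, the
    sphere is centred at the origin and the axis passes through the origin. *)

Section DeriveRules.
Context {R : realType} {V : normedModType R}.
Implicit Types (f g : V -> R) (a b d : R) (x v : V).

Lemma is_derive_fctD (W : normedModType R) (f g : V -> W) x v df dg :
  is_derive x v f df -> is_derive x v g dg ->
  is_derive x v (fun z => f z + g z) (df + dg).
Proof. exact: is_deriveD. Qed.

Lemma is_derive_fctN (W : normedModType R) (f : V -> W) x v df :
  is_derive x v f df -> is_derive x v (fun z => - f z) (- df).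
Proof. exact: is_deriveN. Qed.

Lemma is_derive_fctM f g x v df dg :
  is_derive x v f df -> is_derive x v g dg ->
  is_derive x v (fun z => f z * g z) (f x * dg + g x * df).
Proof. exact: is_deriveM. Qed.

Lemma is_derive_fct_cst (W : normedModType R) (w : W) x v :
  is_derive x v (fun=> w) 0.
Proof. exact: is_derive_cst. Qed.

Lemma is_derive_rowP n (f : V -> 'rV[R]_n) x v (df : 'rV[R]_n) :
  is_derive x v f df <-> forall j, is_derive x v (fun z => f z 0 j) (df 0 j).
Proof.
split=> [[fd <-] j|fd].
  rewrite derive_mx// mxE; apply: derivableP.
  by have /derivable_mxP := fd; exact.
have fdd : derivable f x v.
  by apply/derivable_mxP => i j; rewrite ord1; have [] := fd j.
apply: DeriveDef => //.
by rewrite derive_mx//; apply/rowP => j; rewrite mxE; have [] := fd j.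
Qed.

Lemma is_derive_fctZ n f (g : V -> 'rV[R]_n) x v df dg :
  is_derive x v f df -> is_derive x v g dg ->
  is_derive x v (fun z => f z *: g z) (f x *: dg + df *: g x).
Proof.
move=> fd /is_derive_rowP gd; apply/is_derive_rowP => j.
rewrite !mxE (mulrC df).
rewrite (_ : (fun z => _) = (fun z => f z * g z 0 j)); last first.
  by apply/funext => z; rewrite mxE.
exact: is_derive_fctM fd (gd j).
Qed.

Lemma is_derive_fct_sum (n : nat) (F : 'I_n -> V -> R) x v (dF : 'I_n -> R) :
  (forall i, is_derive x v (F i) (dF i)) ->
  is_derive x v (fun z => \sum_i F i z) (\sum_i dF i).
Proof.
move=> Fd; rewrite (_ : (fun z => _) = \sum_i F i); first exact: is_derive_sum.
by apply/funext => z; rewrite fct_sumE.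
Qed.

Lemma is_derive_dot n (f g : V -> 'rV[R]_n) x v df dg :
  is_derive x v f df -> is_derive x v g dg ->
  is_derive x v (fun z => dot (f z) (g z)) (dot df (g x) + dot (f x) dg).
Proof.
move=> /is_derive_rowP fd /is_derive_rowP gd; rewrite /dot -big_split/=.
apply: is_derive_fct_sum => j.
apply: is_derive_eq (is_derive_fctM (fd j) (gd j)) _.
ring.
Qed.

(** Reduces directional derivatives to one real variable, where the mean value theorem is
    available. *)
Lemma is_derive_line (W : normedModType R) (f : V -> W) x v (s : R) :
  differentiable f (x + s *: v) ->
  is_derive s 1 (fun t : R => f (x + t *: v)) ('D_v f (x + s *: v)).
Proof.
move=> fd; have E : (fun h : R => h^-1 *: (((fun t : R => f (x + t *: v)) \o shift s) (h *: 1)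
    - f (x + s *: v))) =
  (fun h => h^-1 *: ((f \o shift (x + s *: v)) (h *: v) - f (x + s *: v))).
  apply/funext => h /=; congr (_ *: (f _ - _)).
  by rewrite [h *: 1]mulr1 scalerDl addrCA.
apply: DeriveDef; last by rewrite /derive E.
by rewrite /derivable E; exact: diff_derivable.
Qed.

Lemma derive_MVT f x v (t : R) : 0 < t ->
  (forall s, 0 <= s <= t -> differentiable f (x + s *: v)) ->
  exists2 s, 0 < s < t & f (x + t *: v) - f x = t * 'D_v f (x + s *: v).
Proof.
move=> t0 fd.
have [s|s|c] := @MVT R (fun t => f (x + t *: v))
    (fun s => 'D_v f (x + s *: v)) 0 t t0.
- rewrite in_itv/= => /andP[s0 st]; apply: is_derive_line.
  by apply: fd; rewrite !ltW.
- apply: derivable_within_continuous => {}s; rewrite in_itv/= => st.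
  by have [] := is_derive_line (fd s st).
rewrite in_itv/= => c0t; rewrite scale0r addr0 subr0 mulrC => fE.
by exists c.
Qed.

End DeriveRules.

Section Smoothness.
Context {R : realType} {V : normedModType R}.
Implicit Types (U : set V) (k : nat).

(** The little-o expansion of [f] at [x] is also one of [g], and the differential is unique. *)
Lemma near_eq_differentiable (W : normedModType R) (f g : V -> W) x :
  (\forall y \near x, f y = g y) -> differentiable f x -> differentiable g x.
Proof.
move=> fg fd; have fc : continuous ('d f x) by exact: diff_continuous.
have fgx : f x = g x by exact: nbhs_singleton fg.
have gE : g \o shift x = cst (g x) + 'd f x +o_ 0 id.
  apply/eqaddoP => e e0; have /eqaddoP/(_ e e0) := diff_locally fd.
  apply: filterS2; last first.
    have : \forall h \near (0 : V), f (h + x) = g (h + x).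
      have := fg; rewrite (near_shift 0 x); apply: filterS => y /=.
      by rewrite subr0.
    exact.
  by move=> h /= fgh; rewrite !fctE /= fgh -fgx.
apply/diff_locallyP; rewrite (diff_unique fc gE).
by split.
Qed.

Lemma open_near_eq (W : Type) U (f g : V -> W) x : open U ->
  (forall y, U y -> f y = g y) -> U x -> \forall y \near x, f y = g y.
Proof.
by move=> oU fg Ux; have := open_nbhs_nbhs (conj oU Ux); apply: filterS => y /fg.
Qed.

Lemma derive_eq_on (W : normedModType R) U (f g : V -> W) x v : open U ->
  (forall y, U y -> f y = g y) -> U x -> 'D_v f x = 'D_v g x.
Proof. by move=> oU fg Ux; apply: near_eq_derive; exact: open_near_eq fg Ux. Qed.

Lemma Ck_on_eq (W : normedModType R) k U (f g : V -> W) : open U ->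
  (forall x, U x -> f x = g x) -> Ck_on k U f -> Ck_on k U g.
Proof.
move=> oU; elim: k f g => [|k IH] f g fg /=.
  move=> fc x Ux; change (g @ x --> g x); rewrite -(fg x Ux).
  apply: cvg_trans (fc x Ux); apply: near_eq_cvg.
  by apply: filterS (open_near_eq oU fg Ux) => y.
move=> [fd fk]; split.
  by move=> x Ux; apply: near_eq_differentiable (open_near_eq oU fg Ux) (fd x Ux).
by move=> v; apply: IH (fk v) => x Ux; apply: derive_eq_on fg Ux.
Qed.

Lemma Ck_onS (W : normedModType R) k U (f : V -> W) :
  Ck_on k.+1 U f -> Ck_on k U f.
Proof.
elim: k f => [f [fd _] x /fd|k IH f [fd fk]].
  exact: differentiable_continuous.
by split=> // v; apply: IH; exact: fk.
Qed.

Lemma Ck_on_cst (W : normedModType R) k U (w : W) :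
  Ck_on k U (fun _ : V => w).
Proof.
elim: k w => [|k IH] w /=; first by move=> x _; exact: cvg_cst.
split=> [x _|v]; first exact: differentiable_cst.
rewrite (_ : 'D_v _ = fun=> 0); first exact: IH.
by apply/funext => x; rewrite derive_cst.
Qed.

Lemma Ck_onD (W : normedModType R) k U (f g : V -> W) : open U ->
  Ck_on k U f -> Ck_on k U g -> Ck_on k U (fun x => f x + g x).
Proof.
move=> oU; elim: k f g => [|k IH] f g /=.
  by move=> fc gc x Ux; apply: cvgD; [exact: fc|exact: gc].
move=> [fd fk] [gd gk]; split=> [x Ux|v].
  by apply: differentiableD; [exact: fd|exact: gd].
apply: Ck_on_eq (IH _ _ (fk v) (gk v)) => // x Ux.
by rewrite deriveD//; apply: diff_derivable; [exact: fd|exact: gd].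
Qed.

Lemma Ck_onM k U (f g : V -> R) : open U ->
  Ck_on k U f -> Ck_on k U g -> Ck_on k U (fun x => f x * g x).
Proof.
move=> oU; elim: k f g => [|k IH] f g.
  by move=> fc gc x Ux; apply: cvgM; [exact: fc|exact: gc].
move=> fS gS; have fk := Ck_onS fS; have gk := Ck_onS gS.
case: fS gS => [fd fk'] [gd gk']; split=> [x Ux|v].
  by apply: differentiableM; [exact: fd|exact: gd].
apply: Ck_on_eq (Ck_onD oU (IH _ _ fk (gk' v)) (IH _ _ gk (fk' v))) => // x Ux.
rewrite [RHS]deriveM//; apply: diff_derivable; [exact: fd|exact: gd].
Qed.

Lemma Ck_onV k U (f : V -> R) : open U -> (forall x, U x -> f x != 0) ->
  Ck_on k U f -> Ck_on k U (fun x => (f x)^-1).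
Proof.
move=> oU f0; elim: k => [|k IH].
  by move=> fc x Ux; apply: cvgV; [exact: f0|exact: fc].
move=> fS; have ik := IH (Ck_onS fS); case: fS => [fd fk]; split=> [x Ux|v].
  by apply: differentiableV; [exact: fd|exact: f0].
(* The derivative [- f^-2 * 'D_v f], written as a product of factors already known to be [C^k]. *)
have := Ck_onM oU (@Ck_on_cst R k U (-1)) (Ck_onM oU (Ck_onM oU ik ik) (fk v)).
apply: Ck_on_eq => // x Ux.
rewrite [RHS]deriveV; [|exact: f0|exact/diff_derivable/fd].
by rewrite mulN1r -exprVn expr2 scaleNr.
Qed.

Lemma differentiable_sqrt_pos (f : V -> R) x : 0 < f x ->
  differentiable f x -> differentiable (fun y => Num.sqrt (f y)) x.
Proof.
move=> f0 fd; apply: (@differentiable_comp _ _ _ _ f (@Num.sqrt R)) => //.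
by apply/derivable1_diffP; have [] := is_derive1_sqrt f0.
Qed.

Lemma Ck_on_sqrt k U (f : V -> R) : open U -> (forall x, U x -> 0 < f x) ->
  Ck_on k U f -> Ck_on k U (fun x => Num.sqrt (f x)).
Proof.
move=> oU f0; elim: k => [|k IH].
  move=> fc x Ux; apply: continuous_comp; first exact: fc.
  exact: sqrt_continuous.
move=> fS; have ik := IH (Ck_onS fS); case: fS => [fd fk]; split=> [x Ux|v].
  by apply: differentiable_sqrt_pos; [exact: f0|exact: fd].
have ik2 : Ck_on k U (fun x => (2 * Num.sqrt (f x))^-1).
  apply: Ck_onV => //; last by apply: Ck_onM => //; exact: Ck_on_cst.
  by move=> x Ux; rewrite mulf_neq0// gt_eqF// sqrtr_gt0 f0.
apply: Ck_on_eq (Ck_onM oU ik2 (fk v)) => // x Ux.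
have sd := differentiable_sqrt_pos (f0 _ Ux) (fd _ Ux).
have sx0 : Num.sqrt (f x) != 0 by rewrite gt_eqF// sqrtr_gt0 f0.
(* The derivative of the root is found by differentiating [sqrt f * sqrt f = f]. *)
have := @derive_eq_on _ U (fun y => Num.sqrt (f y) * Num.sqrt (f y)) f x v oU.
move=> <-//; last by move=> y Uy; rewrite -expr2 sqr_sqrtr// ltW// f0.
rewrite deriveM; [|exact: diff_derivable..].
by rewrite -mulr2n -scaler_nat /GRing.scale/=; field.
Qed.

Lemma Ck_on_rowP n k U (f : V -> 'rV[R]_n) : open U ->
  Ck_on k U f <-> forall j, Ck_on k U (fun x => f x 0 j).
Proof.
move=> oU; split.
  elim: k f => [|k IH] f.
    move=> fc j x Ux; apply: (@continuous_comp _ _ _ f (fun M => M 0 j)).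
      exact: fc.
    exact: coord_continuous.
  move=> [fd fk] j; split=> [x Ux|v].
    apply: (@differentiable_comp _ _ _ _ f (fun M => M 0 j)); first exact: fd.
    exact: differentiable_coord.
  apply: Ck_on_eq (IH _ (fk v) j) => // x Ux.
  by rewrite derive_mx ?mxE//; exact/diff_derivable/fd.
have fE x : f x = \sum_j f x 0 j *: delta_mx 0 j by exact: row_sum_delta.
elim: k f fE => [|k IH] f fE fj.
  move=> x Ux.
  suff : (\sum_j (fun y => f y 0 j *: delta_mx 0 j : 'rV[R]_n)) @ x -->
         \sum_j f x 0 j *: (delta_mx 0 j : 'rV[R]_n).
    rewrite -(fE x) (_ : \sum_j _ = f)//.
    by apply/funext => y; rewrite fct_sumE -fE.
  apply: (big_ind2 (fun (g : V -> 'rV[R]_n) l => g @ x --> l)).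
  - exact: cvg_cst.
  - by move=> ? ? ? ? ? ?; exact: cvgD.
  - by move=> j _; apply: cvgZr_tmp; exact: fj.
have fd x : U x -> differentiable f x.
  move=> Ux; suff : differentiable
      (\sum_j (fun y => f y 0 j *: delta_mx 0 j : 'rV[R]_n)) x.
    rewrite (_ : \sum_j _ = f)//.
    by apply/funext => y; rewrite fct_sumE -fE.
  apply: differentiable_sum => j; apply: differentiableZl.
  by case: (fj j) => + _; exact.
split=> // v; apply: IH => [x|j]; first exact: row_sum_delta.
case: (fj j) => _ /(_ v); apply: Ck_on_eq => // x Ux.
by rewrite derive_mx ?mxE//; exact/diff_derivable/fd.
Qed.

End Smoothness.

(** * Smooth functions and symmetry of second derivatives *)

Section SmoothOn.
Context {R : realType} {V : normedModType R}.
Implicit Types (U : set V).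

Lemma smooth_on_eq (W : normedModType R) U (f g : V -> W) : open U ->
  (forall x, U x -> f x = g x) -> smooth_on U f -> smooth_on U g.
Proof. by move=> oU fg fs k; exact: Ck_on_eq fg (fs k). Qed.

Lemma Ck_on_sub (W : normedModType R) k U U' (f : V -> W) : U' `<=` U ->
  Ck_on k U f -> Ck_on k U' f.
Proof.
move=> sU; elim: k f => [|k IH] f; first by move=> fc x /sU /fc.
by move=> [fd fk]; split=> [x /sU /fd//|v]; exact/IH/fk.
Qed.

Lemma smooth_on_sub (W : normedModType R) U U' (f : V -> W) : U' `<=` U ->
  smooth_on U f -> smooth_on U' f.
Proof. by move=> sU fs k; exact: Ck_on_sub (fs k). Qed.

Lemma smooth_on_differentiable (W : normedModType R) U (f : V -> W) x :
  smooth_on U f -> U x -> differentiable f x.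
Proof. by move=> /(_ 1%N) [fd _] /fd. Qed.

Lemma smooth_on_is_derive (W : normedModType R) U (f : V -> W) x v :
  smooth_on U f -> U x -> is_derive x v f ('D_v f x).
Proof.
by move=> fs Ux; apply/derivableP/diff_derivable/(smooth_on_differentiable fs Ux).
Qed.

Lemma smooth_on_continuous (W : normedModType R) U (f : V -> W) x :
  smooth_on U f -> U x -> {for x, continuous f}.
Proof. by move=> /(_ 0%N) /= /(_ x). Qed.

Lemma smooth_on_derive (W : normedModType R) U (f : V -> W) v :
  smooth_on U f -> smooth_on U ('D_v f).
Proof. by move=> fs k; have [_] := fs k.+1; exact. Qed.

Lemma smooth_on_cst (W : normedModType R) U (w : W) :
  smooth_on U (fun _ : V => w).
Proof. by move=> k; exact: Ck_on_cst. Qed.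

Lemma smooth_onD (W : normedModType R) U (f g : V -> W) : open U ->
  smooth_on U f -> smooth_on U g -> smooth_on U (fun x => f x + g x).
Proof. by move=> oU fs gs k; exact: Ck_onD. Qed.

Lemma smooth_onM U (f g : V -> R) : open U ->
  smooth_on U f -> smooth_on U g -> smooth_on U (fun x => f x * g x).
Proof. by move=> oU fs gs k; exact: Ck_onM. Qed.

Lemma smooth_onN U (f : V -> R) : open U ->
  smooth_on U f -> smooth_on U (fun x => - f x).
Proof.
move=> oU fs; apply: smooth_on_eq (smooth_onM oU (@smooth_on_cst R U (-1)) fs) => //.
by move=> x _; rewrite mulN1r.
Qed.

Lemma smooth_onB U (f g : V -> R) : open U ->
  smooth_on U f -> smooth_on U g -> smooth_on U (fun x => f x - g x).
Proof. by move=> oU fs gs; apply: smooth_onD => //; exact: smooth_onN. Qed.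

Lemma smooth_onV U (f : V -> R) : open U -> (forall x, U x -> f x != 0) ->
  smooth_on U f -> smooth_on U (fun x => (f x)^-1).
Proof. by move=> oU f0 fs k; exact: Ck_onV. Qed.

Lemma smooth_on_sqrt U (f : V -> R) : open U -> (forall x, U x -> 0 < f x) ->
  smooth_on U f -> smooth_on U (fun x => Num.sqrt (f x)).
Proof. by move=> oU f0 fs k; exact: Ck_on_sqrt. Qed.

Lemma smooth_on_sum n U (F : 'I_n -> V -> R) : open U ->
  (forall i, smooth_on U (F i)) -> smooth_on U (fun x => \sum_i F i x).
Proof.
move=> oU; elim: n F => [|n IH] F Fs.
  apply: smooth_on_eq (@smooth_on_cst R U 0) => // x _.
  by rewrite big_ord0.
apply: smooth_on_eq (smooth_onD oU (IH _ (fun i => Fs (widen_ord (leqnSn n) i))) (Fs ord_max)) => //.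
by move=> x _; rewrite big_ord_recr.
Qed.

Lemma smooth_on_rowP n U (f : V -> 'rV[R]_n) : open U ->
  smooth_on U f <-> forall j, smooth_on U (fun x => f x 0 j).
Proof.
move=> oU; split=> [fs j k|fs k]; first by have /Ck_on_rowP := fs k; exact.
by apply/Ck_on_rowP => // j; exact: fs.
Qed.

Lemma smooth_onZ n U (f : V -> R) (g : V -> 'rV[R]_n) : open U ->
  smooth_on U f -> smooth_on U g -> smooth_on U (fun x => f x *: g x).
Proof.
move=> oU fs /smooth_on_rowP gs; apply/smooth_on_rowP => // j.
apply: smooth_on_eq (smooth_onM oU fs (gs oU j)) => // x _.
by rewrite mxE.
Qed.

Lemma smooth_on_dot n U (f g : V -> 'rV[R]_n) : open U ->
  smooth_on U f -> smooth_on U g -> smooth_on U (fun x => dot (f x) (g x)).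
Proof.
move=> oU /smooth_on_rowP fs /smooth_on_rowP gs.
by apply: smooth_on_sum => // i; apply: smooth_onM; [|exact: fs|exact: gs].
Qed.

Lemma derive_shift_arg (W : normedModType R) (f : V -> W) (a x v : V) :
  'D_v (fun y => f (y + a)) x = 'D_v f (x + a).
Proof.
have E : (fun h : R => h^-1 *: (((fun y => f (y + a)) \o shift x) (h *: v)
    - f (x + a))) =
  (fun h => h^-1 *: ((f \o shift (x + a)) (h *: v) - f (x + a))).
  by apply/funext => h /=; rewrite addrA.
by rewrite /derive E.
Qed.

Lemma differentiable_shift_arg (W : normedModType R) (f : V -> W) (a x : V) :
  differentiable f (x + a) -> differentiable (fun y => f (y + a)) x.
Proof.
move=> fd; apply: (@differentiable_comp _ _ _ _ (fun y => y + a) f) => //.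
Qed.

(** Mean value theorem twice: for [y |-> f (y + t v) - f y] along [u], then for ['D_u f] along [v].
    The set [A] records that the intermediate point is as close to [x] as desired. *)
Lemma second_difference_MVT U (f : V -> R) (x u v : V) (A : set V) :
  open U -> smooth_on U f -> U x -> nbhs x A ->
  exists2 d : R, 0 < d & forall t, 0 < t < d -> exists2 y, A y &
    f (x + t *: u + t *: v) - f (x + t *: u) - (f (x + t *: v) - f x)
    = t ^+ 2 * 'D_v ('D_u f) y.
Proof.
move=> oU fs Ux xA.
have /nbhs_ballP[r /= r0 rAU] : nbhs x (A `&` U).
  by apply: filterI => //; exact: open_nbhs_nbhs.
have d0 : 0 < `|u| + `|v| + 1 by rewrite ltr_wpDl// addr_ge0.
(* With this bound [x + s u + s' v] stays in the ball for [s, s' <= t]; the [+ 1] keeps the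
   denominator positive when [u = v = 0]. *)
exists (r / (`|u| + `|v| + 1)); first exact: divr_gt0.
move=> t /andP[t0]; rewrite ltr_pdivlMr// => tr.
have inAU s s' : 0 <= s <= t -> 0 <= s' <= t -> (A `&` U) (x + s *: u + s' *: v).
  move=> /andP[s0 st] /andP[s'0 s't]; apply: rAU.
  rewrite -ball_normE /= opprD addrA opprD addrA subrr sub0r -opprD normrN.
  apply: le_lt_trans (ler_normD _ _) _; rewrite !normrZ !ger0_norm//.
  apply: le_lt_trans tr.
  have su : s * `|u| <= t * `|u| by exact: ler_wpM2r.
  have s'v : s' * `|v| <= t * `|v| by exact: ler_wpM2r.
  lra.
have t00 : 0 <= (0 : R) <= t by rewrite lexx ltW.
have t0t : 0 <= t <= t by rewrite lexx ltW.
pose g y := f (y + t *: v) - f y.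
have fd s s' : 0 <= s <= t -> 0 <= s' <= t ->
    differentiable f (x + s *: u + s' *: v).
  move=> st s't; apply: (smooth_on_differentiable fs).
  by have [] := inAU _ _ st s't.
have fd0 s : 0 <= s <= t -> differentiable f (x + s *: u).
  by move=> st; have := fd s 0 st t00; rewrite scale0r addr0.
have gd s : 0 <= s <= t -> differentiable (fun y => f (y + t *: v)) (x + s *: u).
  by move=> st; apply: differentiable_shift_arg; exact: fd.
have [s /andP[s0 st] gE] := @derive_MVT R V g x u t t0
  (fun s st => differentiableB (gd s st) (fd0 s st)).
have {}st : 0 <= s <= t by rewrite !ltW.
have us := smooth_on_derive u fs.
have [s' /andP[s'0 s't] hE] := @derive_MVT R V ('D_u f) (x + s *: u) v t t0
  (fun s' s't => smooth_on_differentiable us (inAU _ _ st s't).2).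
exists (x + s *: u + s' *: v).
  by apply: (inAU _ _ _ _).1; rewrite ?st// !ltW.
move: gE; rewrite /g => ->; rewrite deriveB; [|exact: diff_derivable (gd _ _)|exact: diff_derivable (fd0 _ _)].
by rewrite derive_shift_arg hE; ring.
Qed.

(** The second difference is symmetric in [u] and [v], so the two mixed derivatives share a value at
    points arbitrarily close to [x]; by continuity they agree at [x]. *)
Lemma derive_comm U (f : V -> R) (x u v : V) :
  open U -> smooth_on U f -> U x -> 'D_u ('D_v f) x = 'D_v ('D_u f) x.
Proof.
move=> oU fs Ux; apply/eqP; rewrite -subr_eq0; apply/negPn/negP => ne0.
set a := 'D_u _ x in ne0 *; set b := 'D_v _ x in ne0 *.
have e0 : 0 < `|a - b| / 2 by rewrite divr_gt0// normr_gt0.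
have ca : nbhs x [set y | `|a - 'D_u ('D_v f) y| < `|a - b| / 2].
  have := smooth_on_continuous (smooth_on_derive u (smooth_on_derive v fs)) Ux.
  by move=> /cvgrPdist_lt /(_ _ e0).
have cb : nbhs x [set y | `|b - 'D_v ('D_u f) y| < `|a - b| / 2].
  have := smooth_on_continuous (smooth_on_derive v (smooth_on_derive u fs)) Ux.
  by move=> /cvgrPdist_lt /(_ _ e0).
have [d d0 dP] := second_difference_MVT v u oU fs Ux ca.
have [d' d'0 d'P] := second_difference_MVT u v oU fs Ux cb.
pose t := Num.min d d' / 2.
have m0 : 0 < Num.min d d' by rewrite lt_min d0.
have t0 : 0 < t by rewrite divr_gt0.
have tm : t < Num.min d d' by rewrite ltr_pdivrMr// ltr_pMr// ltr1n.
move: (tm); rewrite lt_min => /andP[td td'].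
have [|y /= ya yE] := dP t; first by rewrite t0.
have [|z /= zb zE] := d'P t; first by rewrite t0.
have yz : 'D_u ('D_v f) y = 'D_v ('D_u f) z.
  have t20 : t ^+ 2 != 0 by rewrite expf_neq0// gt_eqF.
  apply: (mulfI t20); apply: etrans (esym yE) (etrans _ zE).
  rewrite (_ : x + t *: v + t *: u = x + t *: u + t *: v); last by rewrite addrAC.
  ring.
have far (p q r s : R) : p = q -> `|r - p| < `|r - s| / 2 ->
    `|s - q| < `|r - s| / 2 -> False.
  move=> -> rq sq; have := ler_distD q r s.
  rewrite [X in _ <= _ + X]distrC leNgt => /negP; apply.
  by rewrite [ltRHS]splitr ltrD.
exact: far yz ya zb.
Qed.

End SmoothOn.

(** * Vector fields and their brackets *)
Opaque derive.

Section VectorFields.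
Context {R : realType}.

Lemma derive_comb (V W : normedModType R) (f : V -> W) x (a b : R) u v :
  differentiable f x ->
  'D_(a *: u + b *: v) f x = a *: 'D_u f x + b *: 'D_v f x.
Proof. by move=> fd; rewrite !deriveE// linearP linearZ. Qed.

Lemma deriveBl (V W : normedModType R) (f : V -> W) x u v :
  differentiable f x -> 'D_(u - v) f x = 'D_u f x - 'D_v f x.
Proof. by move=> fd; rewrite !deriveE// linearB. Qed.

Lemma derive_coord (W : normedModType R) n (f : 'rV[R]_n -> W) x v :
  differentiable f x -> 'D_v f x = \sum_j v 0 j *: 'D_(delta_mx 0 j) f x.
Proof.
move=> fd; rewrite {1}(row_sum_delta v) deriveE// linear_sum.
by apply: eq_bigr => j _; rewrite linearZ/= deriveE.
Qed.

Lemma derive_entry (V : normedModType R) n (f : V -> 'rV[R]_n) x v j :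
  derivable f x v -> ('D_v f x) 0 j = 'D_v (fun y => f y 0 j) x.
Proof. by move=> fd; rewrite derive_mx// mxE. Qed.

Variables (n : nat) (U : set 'rV[R]_n).
Hypothesis oU : open U.
Implicit Types X Y : 'rV[R]_n -> 'rV[R]_n.

Lemma smooth_on_derive_field_scalar X (f : 'rV[R]_n -> R) :
  smooth_on U X -> smooth_on U f -> smooth_on U (fun x => 'D_(X x) f x).
Proof.
move=> /smooth_on_rowP Xs fs.
apply: (@smooth_on_eq _ _ _ U
  (fun x => \sum_j X x 0 j * 'D_(delta_mx 0 j) f x)) => //.
  move=> x Ux; rewrite [RHS]derive_coord//; exact: smooth_on_differentiable fs Ux.
apply: smooth_on_sum => // j.
by apply: smooth_onM => //; [exact: Xs|exact: smooth_on_derive].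
Qed.

Lemma smooth_on_derive_field m X (f : 'rV[R]_n -> 'rV[R]_m) :
  smooth_on U X -> smooth_on U f -> smooth_on U (fun x => 'D_(X x) f x).
Proof.
move=> Xs fs; apply/smooth_on_rowP => // j.
have /smooth_on_rowP fj := fs.
apply: smooth_on_eq (smooth_on_derive_field_scalar Xs (fj oU j)) => // x Ux.
by rewrite derive_entry//; exact/diff_derivable/(smooth_on_differentiable fs Ux).
Qed.

Lemma derive_derive_field Y (f : 'rV[R]_n -> R) x v :
  smooth_on U Y -> smooth_on U f -> U x ->
  'D_v (fun y => 'D_(Y y) f y) x = 'D_('D_v Y x) f x + 'D_(Y x) ('D_v f) x.
Proof.
move=> Ys fs Ux; have /smooth_on_rowP Yj := Ys.
have fd y : U y -> differentiable f y by exact: smooth_on_differentiable.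
have vfd : differentiable ('D_v f) x.
  by apply: smooth_on_differentiable Ux; exact: smooth_on_derive.
rewrite (@derive_eq_on _ _ _ U _
  (fun y => \sum_j Y y 0 j * 'D_(delta_mx 0 j) f y))//; last first.
  by move=> y Uy; rewrite derive_coord//; exact: fd.
have sd j : is_derive x v (fun y => Y y 0 j * 'D_(delta_mx 0 j) f y)
    (Y x 0 j * 'D_v ('D_(delta_mx 0 j) f) x +
     'D_(delta_mx 0 j) f x * 'D_v (fun y => Y y 0 j) x).
  apply: is_derive_fctM; first exact: smooth_on_is_derive (Yj oU j) Ux.
  exact: smooth_on_is_derive (smooth_on_derive _ fs) Ux.
rewrite (@derive_val _ _ _ _ _ _ _ (is_derive_fct_sum sd)).
rewrite big_split/= addrC (derive_coord ('D_v Y x) (fd _ Ux)).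
rewrite (derive_coord (Y x) vfd).
have Yd := smooth_on_is_derive v Ys Ux.
apply: (congr2 +%R); apply: eq_bigr => j _.
  by rewrite mulrC derive_entry//; exact: ex_derive.
by rewrite (derive_comm v _ oU fs Ux).
Qed.

(** The second-order terms cancel by symmetry, leaving the derivative along the bracket [[X, Y] =
    D_X Y - D_Y X]. *)
Lemma lie_bracket_scalar X Y (f : 'rV[R]_n -> R) x :
  smooth_on U X -> smooth_on U Y -> smooth_on U f -> U x ->
  'D_(X x) (fun y => 'D_(Y y) f y) x - 'D_(Y x) (fun y => 'D_(X y) f y) x =
  'D_('D_(X x) Y x - 'D_(Y x) X x) f x.
Proof.
move=> Xs Ys fs Ux; have fd := smooth_on_differentiable fs Ux.
rewrite (derive_derive_field (X x) Ys fs Ux) (derive_derive_field (Y x) Xs fs Ux).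
have alg (a b c d : R) : d = c -> a + c - (b + d) = a - b by move=> ->; ring.
apply: etrans (esym (deriveBl _ _ fd)); apply: alg.
exact: derive_comm fs Ux.
Qed.

(** The only integrability condition used below: applied to [x], [n] and [e1] it gives the bracket
    of the frame, Codazzi's equations and Gauss's equation. *)
Lemma lie_bracketE m X Y (f : 'rV[R]_n -> 'rV[R]_m) x :
  smooth_on U X -> smooth_on U Y -> smooth_on U f -> U x ->
  'D_(X x) (fun y => 'D_(Y y) f y) x - 'D_(Y x) (fun y => 'D_(X y) f y) x =
  'D_('D_(X x) Y x - 'D_(Y x) X x) f x.
Proof.
move=> Xs Ys fs Ux; have /smooth_on_rowP fj := fs.
have fd v y : U y -> derivable f y v.
  by move=> Uy; exact/diff_derivable/(smooth_on_differentiable fs Uy).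
have E X' Y' j : smooth_on U X' -> smooth_on U Y' ->
    ('D_(X' x) (fun y => 'D_(Y' y) f y) x) 0 j =
    'D_(X' x) (fun y => 'D_(Y' y) (fun z => f z 0 j) y) x.
  move=> Xs' Ys'; rewrite derive_entry.
    apply: (@derive_eq_on _ _ _ U) => // y Uy.
    by rewrite derive_entry//; exact: fd.
  apply/diff_derivable/(smooth_on_differentiable _ Ux).
  exact: smooth_on_derive_field.
have subE (A B : 'rV[R]_m) j : (A - B) 0 j = A 0 j - B 0 j by rewrite !mxE.
apply/rowP => j; apply: etrans (subE _ _ j) _.
apply: etrans (congr2 (fun a b => a - b) (E X Y j Xs Ys) (E Y X j Ys Xs)) _.
apply: etrans (lie_bracket_scalar Xs Ys (fj oU j) Ux) _.
exact: esym (derive_entry j (fd _ _ Ux)).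
Qed.

End VectorFields.

(** * Maps with vanishing differential *)

Section LocallyConstant.
Context {R : realType}.

(** Balls are convex, so the mean value theorem applies along the segment from [x] to [y]. *)
Lemma derive0_near_cst (V : normedModType R) (U : set V) (f : V -> R) x :
  open U -> (forall y, U y -> differentiable f y) ->
  (forall y v, U y -> 'D_v f y = 0) -> U x -> \forall y \near x, f y = f x.
Proof.
move=> oU fd f0 Ux; have /nbhs_ballP[r /= r0 rU] := open_nbhs_nbhs (conj oU Ux).
apply/nbhs_ballP; exists r => //= y xy.
have inU s : 0 <= s <= 1 -> U (x + s *: (y - x)).
  move=> /andP[s0 s1]; apply: rU; move: xy; rewrite -!ball_normE /=.
  rewrite opprD addrA subrr sub0r normrN normrZ ger0_norm// distrC.
  by apply: le_lt_trans; rewrite ler_piMl.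
have [s /andP[s0 s1]] := @derive_MVT R V f x (y - x) 1 ltr01
  (fun s s1 => fd _ (inU s s1)).
rewrite scale1r f0 ?mulr0; last by apply: inU; rewrite !ltW.
by move=> /eqP; rewrite subr_eq0 addrC subrK => /eqP.
Qed.

Lemma derive0_near_cst_row (V : normedModType R) n (U : set V)
    (f : V -> 'rV[R]_n) x :
  open U -> (forall y, U y -> differentiable f y) ->
  (forall y v, U y -> 'D_v f y = 0) -> U x -> \forall y \near x, f y = f x.
Proof.
move=> oU fd f0 Ux.
have : \forall y \near x, forall j, f y 0 j = f x 0 j.
  apply: filter_forall => j.
  apply: (@derive0_near_cst _ U (fun y => f y 0 j)) => // [y Uy|y v Uy].
    apply: (@differentiable_comp _ _ _ _ f (fun M => M 0 j)); first exact: fd.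
    exact: differentiable_coord.
  by rewrite -derive_entry ?f0 ?mxE//; exact/diff_derivable/fd.
by apply: filterS => y yx; apply/rowP.
Qed.

(** Every preimage under [f] is open, so the fibre through [p] is both open and closed. *)
Lemma near_cst_connected (T : topologicalType) (W : Type) (f : T -> W) :
  connected [set: T] -> (forall p, \forall q \near p, f q = f p) ->
  forall p q, f p = f q.
Proof.
move=> Tc fc p q.
have oP (P : set W) : open (f @^-1` P).
  by rewrite openE => r /= Pr; rewrite /interior; apply: filterS (fc r) => s /= ->.
have : [set r | f r = f p] = setT.
  apply: Tc; first by exists p.
    by exists [set r | f r = f p]; rewrite ?setTI//; exact: (oP [set w | w = f p]).
  exists [set r | f r = f p]; rewrite ?setTI//.
  by rewrite -openC; exact: (oP [set w | w <> f p]).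
by move=> /seteqP[_ /(_ q I)] /= ->.
Qed.

End LocallyConstant.

(** * Orthonormal principal frames *)
Section Dot.
Context {R : realType} {n : nat}.
Implicit Types (u v w : 'rV[R]_n) (a : R).

Lemma dotC u v : dot u v = dot v u.
Proof. by apply: eq_bigr => i _; rewrite mulrC. Qed.

Lemma dotDl u v w : dot (u + v) w = dot u w + dot v w.
Proof. by rewrite /dot -big_split; apply: eq_bigr => i _; rewrite mxE mulrDl. Qed.

Lemma dotZl a u v : dot (a *: u) v = a * dot u v.
Proof. by rewrite /dot mulr_sumr; apply: eq_bigr => i _; rewrite mxE mulrA. Qed.

Lemma dotNl u v : dot (- u) v = - dot u v.
Proof. by rewrite -scaleN1r dotZl mulN1r. Qed.

Lemma dotBl u v w : dot (u - v) w = dot u w - dot v w.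
Proof. by rewrite dotDl dotNl. Qed.

Lemma dot0l u : dot 0 u = 0.
Proof. by rewrite -(scale0r 0) dotZl mul0r. Qed.

Lemma dotDr u v w : dot w (u + v) = dot w u + dot w v.
Proof. by rewrite !(dotC w) dotDl. Qed.

Lemma dotZr a u v : dot u (a *: v) = a * dot u v.
Proof. by rewrite !(dotC u) dotZl. Qed.

Lemma dotNr u v : dot u (- v) = - dot u v.
Proof. by rewrite !(dotC u) dotNl. Qed.

Lemma dotBr u v w : dot w (u - v) = dot w u - dot w v.
Proof. by rewrite !(dotC w) dotBl. Qed.

Lemma dot0r u : dot u 0 = 0.
Proof. by rewrite dotC dot0l. Qed.

Lemma dot_ge0 u : 0 <= dot u u.
Proof. by apply: sumr_ge0 => i _; rewrite -expr2 sqr_ge0. Qed.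

Lemma dot_eq0 u : (dot u u == 0) = (u == 0).
Proof.
apply/eqP/eqP => [|->]; last by rewrite dot0l.
move=> /eqP; rewrite psumr_eq0; last by move=> i _; rewrite -expr2 sqr_ge0.
move=> /allP u0; apply/rowP => i; rewrite mxE.
by have := u0 i (mem_index_enum i); rewrite mulf_eq0 orbb => /eqP.
Qed.

Lemma dot_gt0 u : u != 0 -> 0 < dot u u.
Proof. by move=> u0; rewrite lt_def dot_eq0 u0 dot_ge0. Qed.

Lemma dot_mulmx (u v : 'rV[R]_n) : u *m v^T = (dot u v)%:M.
Proof.
apply/matrixP => i j; rewrite !ord1 !mxE eqxx mulr1n.
by apply: eq_bigr => k _; rewrite mxE.
Qed.

End Dot.

Definition dotE := (@dotDl, @dotDr, @dotBl, @dotBr, @dotNl, @dotNr, @dotZl, @dotZr).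

(** The matrix [M] with rows [e1, e2, e3] satisfies [M M^T = 1], hence [M^T M = 1] and
    [a = (a M^T) M]. *)
Lemma orthonormal_expansion (R : realType) (e1 e2 e3 a : 'rV[R]_3) :
  dot e1 e1 = 1 -> dot e2 e2 = 1 -> dot e3 e3 = 1 ->
  dot e1 e2 = 0 -> dot e1 e3 = 0 -> dot e2 e3 = 0 ->
  a = dot a e1 *: e1 + dot a e2 *: e2 + dot a e3 *: e3.
Proof.
move=> e11 e22 e33 e12 e13 e23.
pose M : 'M[R]_3 := \matrix_(i < 3) tnth [tuple e1; e2; e3] i.
have MMt : M *m M^T = 1%:M.
  apply/matrixP => i j.
  rewrite [RHS]mxE (_ : (M *m M^T) i j = dot (row i M) (row j M)); last first.
    by rewrite mxE; apply: eq_bigr => k _; rewrite !mxE.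
  rewrite !rowK; move: i j.
  do 2 (case; case=> [|[|[|//]]] ?); rewrite /= ?(tnth_nth 0)/= ?mulr1n ?mulr0n //.
  - by rewrite dotC.
  - by rewrite dotC.
  - by rewrite dotC.
rewrite -[LHS]mulmx1 -(mulmx1C MMt) mulmxA mulmx_sum_row.
have cE i : (a *m M^T) 0 i = dot a (row i M).
  by rewrite mxE; apply: eq_bigr => k _; rewrite !mxE.
rewrite !big_ord_recl big_ord0 addr0 !cE !rowK !(tnth_nth 0)/=.
by rewrite addrA.
Qed.

(** [X1] and [X2] are the parameter-plane fields mapped by dx to [e1] and [e2], so that
    differentiation along the frame is an ordinary ['D_(X1 z)] or ['D_(X2 z)]. With principal
    curvatures [H + mu] and [H - mu] and [H] constant, [mu] is the only unknown curvature
    function. *)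
Record principal_frame (R : realType) (U : set 'rV[R]_2)
    (x n e1 e2 : 'rV[R]_2 -> 'rV[R]_3) (X1 X2 : 'rV[R]_2 -> 'rV[R]_2)
    (mu : 'rV[R]_2 -> R) (H : R) : Prop := PrincipalFrame {
  frame_open : open U;
  frame_x : smooth_on U x;
  frame_n : smooth_on U n;
  frame_e1 : smooth_on U e1;
  frame_e2 : smooth_on U e2;
  frame_X1 : smooth_on U X1;
  frame_X2 : smooth_on U X2;
  frame_mu : smooth_on U mu;
  frame_inj : forall z v, U z -> 'D_v x z = 0 -> v = 0;
  frame_Dx1 : forall z, U z -> 'D_(X1 z) x z = e1 z;
  frame_Dx2 : forall z, U z -> 'D_(X2 z) x z = e2 z;
  frame_Dn1 : forall z, U z -> 'D_(X1 z) n z = (- (H + mu z)) *: e1 z;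
  frame_Dn2 : forall z, U z -> 'D_(X2 z) n z = (- (H - mu z)) *: e2 z;
  frame_e11 : forall z, U z -> dot (e1 z) (e1 z) = 1;
  frame_e22 : forall z, U z -> dot (e2 z) (e2 z) = 1;
  frame_nn : forall z, U z -> dot (n z) (n z) = 1;
  frame_e12 : forall z, U z -> dot (e1 z) (e2 z) = 0;
  frame_e1n : forall z, U z -> dot (e1 z) (n z) = 0;
  frame_e2n : forall z, U z -> dot (e2 z) (n z) = 0
}.

(** The sign change of [mu] exchanges the two curvatures; a result about the first direction thereby
    yields one about the second. *)
Lemma principal_frame_swap (R : realType) (U : set 'rV[R]_2)
    x n e1 e2 X1 X2 mu H :
  principal_frame U x n e1 e2 X1 X2 mu H ->
  principal_frame U x n e2 e1 X2 X1 (fun z => - mu z) H.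
Proof.
case=> *; split=> //.
- exact: smooth_onN.
- by move=> z Uz; rewrite opprK; eauto.
- by move=> z Uz; rewrite dotC; eauto.
Qed.

Section FrameEquations.
Context {R : realType} (U : set 'rV[R]_2).
Context (x n e1 e2 : 'rV[R]_2 -> 'rV[R]_3) (X1 X2 : 'rV[R]_2 -> 'rV[R]_2).
Context (mu : 'rV[R]_2 -> R) (H : R).
Hypothesis F : principal_frame U x n e1 e2 X1 X2 mu H.
Implicit Types z v : 'rV[R]_2.

Let oU : open U := frame_open F.

(* Connection coefficients of the frame in the directions e1 and e2. *)
Definition frame_w1 z := dot ('D_(X1 z) e1 z) (e2 z).
Definition frame_w2 z := dot ('D_(X2 z) e1 z) (e2 z).
Local Notation w1 := frame_w1.
Local Notation w2 := frame_w2.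

Lemma derive_dot_cst (f g : 'rV[R]_2 -> 'rV[R]_3) (c : R) z v :
  smooth_on U f -> smooth_on U g -> U z ->
  (forall y, U y -> dot (f y) (g y) = c) ->
  dot ('D_v f z) (g z) + dot (f z) ('D_v g z) = 0.
Proof.
move=> fs gs Uz fg.
have fd := smooth_on_is_derive v fs Uz.
have gd := smooth_on_is_derive v gs Uz.
rewrite -(@derive_val _ _ _ _ _ _ _ (is_derive_dot fd gd)).
by rewrite (derive_eq_on _ oU fg Uz) derive_cst.
Qed.

Let expand a z : U z ->
  a = dot a (e1 z) *: e1 z + dot a (e2 z) *: e2 z + dot a (n z) *: n z.
Proof.
case: F => *; apply: orthonormal_expansion; eauto.
Qed.

(** Differentiating [<e1, e1> = 1] and [<e1, n> = 0] gives the [e1] and [n] components; the [e2]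
    component is [w1] by definition. The next three lemmas are obtained alike. *)
Lemma frame_derive_e11 z : U z ->
  is_derive z (X1 z) e1 (w1 z *: e2 z + (H + mu z) *: n z).
Proof.
move=> Uz; have := smooth_on_is_derive (X1 z) (frame_e1 F) Uz.
rewrite [X in is_derive _ _ _ X](expand _ Uz) -/(w1 z).
have := derive_dot_cst (X1 z) (frame_e1 F) (frame_e1 F) Uz (frame_e11 F).
have := derive_dot_cst (X1 z) (frame_e1 F) (frame_n F) Uz (frame_e1n F).
rewrite (frame_Dn1 F Uz) !dotE (frame_e11 F Uz) [dot (e1 z) _]dotC => a b.
have -> : dot ('D_(X1 z) e1 z) (e1 z) = 0 by lra.
have -> : dot ('D_(X1 z) e1 z) (n z) = H + mu z by lra.
by rewrite scale0r add0r.
Qed.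

Lemma frame_derive_e12 z : U z -> is_derive z (X2 z) e1 (w2 z *: e2 z).
Proof.
move=> Uz; have := smooth_on_is_derive (X2 z) (frame_e1 F) Uz.
rewrite [X in is_derive _ _ _ X](expand _ Uz) -/(w2 z).
have := derive_dot_cst (X2 z) (frame_e1 F) (frame_e1 F) Uz (frame_e11 F).
have := derive_dot_cst (X2 z) (frame_e1 F) (frame_n F) Uz (frame_e1n F).
rewrite (frame_Dn2 F Uz) !dotE (frame_e12 F Uz) [dot (e1 z) _]dotC => a b.
have -> : dot ('D_(X2 z) e1 z) (e1 z) = 0 by lra.
have -> : dot ('D_(X2 z) e1 z) (n z) = 0 by lra.
by rewrite !scale0r add0r addr0.
Qed.

Lemma frame_derive_e21 z : U z -> is_derive z (X1 z) e2 (- w1 z *: e1 z).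
Proof.
move=> Uz; have := smooth_on_is_derive (X1 z) (frame_e2 F) Uz.
rewrite [X in is_derive _ _ _ X](expand _ Uz).
have := derive_dot_cst (X1 z) (frame_e2 F) (frame_e2 F) Uz (frame_e22 F).
have := derive_dot_cst (X1 z) (frame_e2 F) (frame_n F) Uz (frame_e2n F).
have := derive_dot_cst (X1 z) (frame_e1 F) (frame_e2 F) Uz (frame_e12 F).
rewrite -/(w1 z).
rewrite (frame_Dn1 F Uz) !dotE ![dot (e2 z) _]dotC (frame_e12 F Uz).
rewrite ![dot (e1 z) _]dotC => a b c.
have -> : dot ('D_(X1 z) e2 z) (e1 z) = - w1 z by lra.
have -> : dot ('D_(X1 z) e2 z) (n z) = 0 by lra.
have -> : dot ('D_(X1 z) e2 z) (e2 z) = 0 by lra.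
by rewrite !scale0r !addr0.
Qed.

Lemma frame_derive_e22 z : U z ->
  is_derive z (X2 z) e2 (- w2 z *: e1 z + (H - mu z) *: n z).
Proof.
move=> Uz; have := smooth_on_is_derive (X2 z) (frame_e2 F) Uz.
rewrite [X in is_derive _ _ _ X](expand _ Uz).
have := derive_dot_cst (X2 z) (frame_e2 F) (frame_e2 F) Uz (frame_e22 F).
have := derive_dot_cst (X2 z) (frame_e2 F) (frame_n F) Uz (frame_e2n F).
have := derive_dot_cst (X2 z) (frame_e1 F) (frame_e2 F) Uz (frame_e12 F).
rewrite -/(w2 z).
rewrite (frame_Dn2 F Uz) !dotE (frame_e22 F Uz) [dot (e2 z) _]dotC.
rewrite ![dot (e1 z) _]dotC => a b c.
have -> : dot ('D_(X2 z) e2 z) (e1 z) = - w2 z by lra.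
have -> : dot ('D_(X2 z) e2 z) (n z) = H - mu z by lra.
have -> : dot ('D_(X2 z) e2 z) (e2 z) = 0 by lra.
by rewrite !scale0r !addr0.
Qed.

Let simp_dots z : U z ->
  ((dot (e1 z) (e1 z) = 1) * (dot (e2 z) (e2 z) = 1) * (dot (n z) (n z) = 1) *
   (dot (e1 z) (e2 z) = 0) * (dot (e2 z) (e1 z) = 0) *
   (dot (e1 z) (n z) = 0) * (dot (n z) (e1 z) = 0) *
   (dot (e2 z) (n z) = 0) * (dot (n z) (e2 z) = 0))%type.
Proof.
move=> Uz; rewrite ![dot (n z) (e1 z)]dotC ![dot (n z) (e2 z)]dotC.
rewrite [dot (e2 z) (e1 z)]dotC.
by rewrite (frame_e11 F Uz) (frame_e22 F Uz) (frame_nn F Uz) (frame_e12 F Uz)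
  (frame_e1n F Uz) (frame_e2n F Uz).
Qed.

(** As dx is injective, it suffices to compare images under dx, and that of the bracket is
    [D_1 e2 - D_2 e1]. *)
Lemma frame_lie_bracket z : U z ->
  'D_(X1 z) X2 z - 'D_(X2 z) X1 z = (- w1 z) *: X1 z + (- w2 z) *: X2 z.
Proof.
move=> Uz; apply/eqP; rewrite -subr_eq0; apply/eqP/(frame_inj F Uz).
have xd := smooth_on_differentiable (frame_x F) Uz.
rewrite deriveBl// derive_comb//.
have := lie_bracketE oU (frame_X1 F) (frame_X2 F) (frame_x F) Uz.
rewrite (derive_eq_on _ oU (frame_Dx2 F) Uz) (derive_eq_on _ oU (frame_Dx1 F) Uz).
move=> <-; rewrite (frame_Dx1 F Uz) (frame_Dx2 F Uz).
rewrite (@derive_val _ _ _ _ _ _ _ (frame_derive_e21 Uz)).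
rewrite (@derive_val _ _ _ _ _ _ _ (frame_derive_e12 Uz)).
have alg (a b : 'rV[R]_3) (s t : R) :
    (- s) *: a - t *: b - ((- s) *: a + (- t) *: b) = 0.
  by rewrite [(- t) *: b]scaleNr subrr.
exact: alg.
Qed.

(** The [e1] and [e2] components of the bracket identity for [n]. *)
Lemma frame_codazzi z m1 m2 : U z ->
  is_derive z (X1 z) mu m1 -> is_derive z (X2 z) mu m2 ->
  2 * mu z * w1 z = m2 /\ 2 * mu z * w2 z = - m1.
Proof.
move=> Uz md1 md2; have nd := smooth_on_differentiable (frame_n F) Uz.
have := lie_bracketE oU (frame_X1 F) (frame_X2 F) (frame_n F) Uz.
rewrite (derive_eq_on _ oU (frame_Dn2 F) Uz) (derive_eq_on _ oU (frame_Dn1 F) Uz).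
rewrite frame_lie_bracket// derive_comb// (frame_Dn1 F Uz) (frame_Dn2 F Uz).
have Hd v := is_derive_fct_cst H z v.
have d1 := is_derive_fctZ
  (is_derive_fctN (is_derive_fctD (Hd _) (is_derive_fctN md1)))
  (frame_derive_e21 Uz).
have d2 := is_derive_fctZ
  (is_derive_fctN (is_derive_fctD (Hd _) md2)) (frame_derive_e12 Uz).
rewrite (@derive_val _ _ _ _ _ _ _ d1) (@derive_val _ _ _ _ _ _ _ d2) => E.
have := congr1 (fun a => dot a (e1 z)) E.
have := congr1 (fun a => dot a (e2 z)) E.
rewrite /= !dotE !simp_dots// => E2 E1; split; lra.
Qed.

Lemma smooth_on_w1 : smooth_on U w1.
Proof.
apply: smooth_on_dot => //; last exact: frame_e2 F.
by apply: smooth_on_derive_field => //; [exact: frame_X1 F|exact: frame_e1 F].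
Qed.

Lemma smooth_on_w2 : smooth_on U w2.
Proof.
apply: smooth_on_dot => //; last exact: frame_e2 F.
by apply: smooth_on_derive_field => //; [exact: frame_X2 F|exact: frame_e1 F].
Qed.

(** The [e2] component of the bracket identity for [e1]. *)
Lemma frame_gauss z p q : U z ->
  is_derive z (X1 z) w2 p -> is_derive z (X2 z) w1 q ->
  p - q + (H + mu z) * (H - mu z) + w1 z ^+ 2 + w2 z ^+ 2 = 0.
Proof.
move=> Uz w2d w1d.
move: ('D_(X2 z) mu z) (smooth_on_is_derive (X2 z) (frame_mu F) Uz) => r mud.
have ed := smooth_on_differentiable (frame_e1 F) Uz.
have := lie_bracketE oU (frame_X1 F) (frame_X2 F) (frame_e1 F) Uz.
have D1e1 y : U y -> 'D_(X1 y) e1 y = w1 y *: e2 y + (H + mu y) *: n y.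
  by move=> Uy; exact: (@derive_val _ _ _ _ _ _ _ (frame_derive_e11 Uy)).
have D2e1 y : U y -> 'D_(X2 y) e1 y = w2 y *: e2 y.
  by move=> Uy; exact: (@derive_val _ _ _ _ _ _ _ (frame_derive_e12 Uy)).
rewrite (derive_eq_on _ oU D1e1 Uz) (derive_eq_on _ oU D2e1 Uz).
rewrite frame_lie_bracket// derive_comb// D1e1// D2e1//.
have Hd v := is_derive_fct_cst H z v.
have d1 := is_derive_fctZ w2d
  (frame_derive_e21 Uz).
have nd := smooth_on_is_derive (X2 z) (frame_n F) Uz.
rewrite (frame_Dn2 F Uz) in nd.
have d2 := is_derive_fctD
  (is_derive_fctZ w1d
    (frame_derive_e22 Uz))
  (is_derive_fctZ (is_derive_fctD (Hd _) mud) nd).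
rewrite (@derive_val _ _ _ _ _ _ _ d1) (@derive_val _ _ _ _ _ _ _ d2) => E.
have := congr1 (fun a => dot a (e2 z)) E.
rewrite /= !dotE !simp_dots//.
move=> E2; lra.
Qed.

End FrameEquations.

(** * Shrinkers in a principal frame *)
Section ShrinkerAlgebra.
Context {R : realType}.
Variables (H mu al la h m1 m2 w1 w2 p1 p2 : R).
Hypotheses (al0 : al != 0) (mu0 : mu != 0) (k10 : H + mu != 0) (k20 : H - mu != 0).
Hypotheses (hE : H ^+ 2 - mu ^+ 2 = al * h + la)
  (w1E : 2 * mu * w1 = m2) (w2E : 2 * mu * w2 = - m1)
  (p1E : 2 * mu * m1 = al * (H + mu) * p1)
  (p2E : 2 * mu * m2 = al * (H - mu) * p2).

Let mul2 : 2 * mu != 0.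
Proof. by rewrite mulf_neq0. Qed.
Let hS : h = (H ^+ 2 - mu ^+ 2 - la) / al.
Proof. by rewrite hE addrK mulrC mulKf. Qed.
Let w1S : w1 = m2 / (2 * mu).
Proof. by rewrite -w1E mulrC mulKf. Qed.
Let w2S : w2 = - m1 / (2 * mu).
Proof. by rewrite -w2E mulrC mulKf. Qed.
Let p1S : p1 = 2 * mu * m1 / (al * (H + mu)).
Proof. by rewrite p1E mulrC mulKf// mulf_neq0. Qed.
Let p2S : p2 = 2 * mu * m2 / (al * (H - mu)).
Proof. by rewrite p2E mulrC mulKf// mulf_neq0. Qed.

(** Pointwise algebra: [a11, a22, b12, b21] stand for [e1(m1), e2(m2), e1(w2), e2(w1)], and [p1, p2]
    for the tangential components of the position vector. *)
Lemma shrinker_gradient_identity (a11 a22 b12 b21 : R) :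
  2 * (m1 ^+ 2 + mu * a11) =
    al * (m1 * p1 + (H + mu) * (1 + w1 * p2 + (H + mu) * h)) ->
  2 * (m2 ^+ 2 + mu * a22) =
    al * (- m2 * p2 + (H - mu) * (1 - w2 * p1 + (H - mu) * h)) ->
  2 * (m2 * w1 + mu * b21) = a22 ->
  2 * (m1 * w2 + mu * b12) = - a11 ->
  b12 - b21 + (H + mu) * (H - mu) + w1 ^+ 2 + w2 ^+ 2 = 0 ->
  2 * (m1 ^+ 2 + m2 ^+ 2) =
    al * H + (H ^+ 2 - mu ^+ 2) ^+ 2 - la * (H ^+ 2 + mu ^+ 2).
Proof.
move=> a11E a22E b21E b12E G.
have b21S : b21 = (a22 - 2 * m2 * w1) / (2 * mu) by rewrite -b21E; field.
have b12S : b12 = (- a11 - 2 * m1 * w2) / (2 * mu) by rewrite -b12E; field.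
have a11S : a11 = (al * (m1 * p1 + (H + mu) * (1 + w1 * p2 + (H + mu) * h))
    - 2 * m1 ^+ 2) / (2 * mu) by rewrite -a11E; field.
have a22S : a22 = (al * (- m2 * p2 + (H - mu) * (1 - w2 * p1 + (H - mu) * h))
    - 2 * m2 ^+ 2) / (2 * mu) by rewrite -a22E; field.
apply/eqP; rewrite -subr_eq0; apply/eqP.
(* Once everything is expressed through [m1], [m2], [mu] and the constants, the difference of the
   two sides is exactly [2 mu^2] times the left side of Gauss's equation. *)
transitivity (2 * mu ^+ 2 *
  (b12 - b21 + (H + mu) * (H - mu) + w1 ^+ 2 + w2 ^+ 2)); last by rewrite G mulr0.
rewrite b21S b12S a11S a22S w1S w2S p1S p2S hS; field.
by rewrite al0 mu0 k10 k20.
Qed.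

(** After substitution, the terms of [2 mu (m1 a11 + m2 a12)] that are cubic in [m1, m2] collapse to
    [- 2 H / (H + mu) * m1 (m1^2 + m2^2)]; the gradient identity then removes them and leaves [m1]
    times a polynomial in [mu]. *)
Lemma shrinker_gradient_derived (a11 a12 : R) :
  2 * (m1 ^+ 2 + mu * a11) =
    al * (m1 * p1 + (H + mu) * (1 + w1 * p2 + (H + mu) * h)) ->
  2 * (m1 * m2 + mu * a12) = al * (- m1 * p2 - (H - mu) * w1 * p1) ->
  2 * (m1 ^+ 2 + m2 ^+ 2) =
    al * H + (H ^+ 2 - mu ^+ 2) ^+ 2 - la * (H ^+ 2 + mu ^+ 2) ->
  4 * (m1 * a11 + m2 * a12) =
    (- 4 * mu * (H ^+ 2 - mu ^+ 2) - 2 * la * mu) * m1 ->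
  m1 * ((H + mu) * mu * (- 4 * mu * (H ^+ 2 - mu ^+ 2) - 2 * la * mu)
    + 2 * H * (al * H + (H ^+ 2 - mu ^+ 2) ^+ 2 - la * (H ^+ 2 + mu ^+ 2))
    - 2 * (H + mu) ^+ 2 * (al + (H + mu) * (H ^+ 2 - mu ^+ 2 - la))) = 0.
Proof.
move=> a11E a12E A B.
have a11S : a11 = (al * (m1 * p1 + (H + mu) * (1 + w1 * p2 + (H + mu) * h))
    - 2 * m1 ^+ 2) / (2 * mu) by rewrite -a11E; field.
have a12S : a12 = (al * (- m1 * p2 - (H - mu) * w1 * p1) - 2 * m1 * m2) / (2 * mu).
  by rewrite -a12E; field.
(* The factor [mu (H + mu)] clears the denominators of the derived identity; [- 2 H m1] is what
   cancels the remaining [m1 (m1^2 + m2^2)]. *)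
transitivity (- 2 * H * m1 * (2 * (m1 ^+ 2 + m2 ^+ 2) -
    (al * H + (H ^+ 2 - mu ^+ 2) ^+ 2 - la * (H ^+ 2 + mu ^+ 2)))
  - mu * (H + mu) * (4 * (m1 * a11 + m2 * a12) -
    (- 4 * mu * (H ^+ 2 - mu ^+ 2) - 2 * la * mu) * m1)); last first.
  by rewrite A B !subrr !mulr0 subrr.
rewrite a11S a12S w1S p1S p2S hS; field.
by rewrite al0 mu0 k10 k20.
Qed.

End ShrinkerAlgebra.

Lemma open_neq0 (R : realType) (V : normedModType R) (U : set V) (f : V -> R) :
  open U -> (forall z, U z -> {for z, continuous f}) ->
  open [set z | U z /\ f z != 0].
Proof.
move=> oU fc; rewrite openE => z [Uz fz]; rewrite /interior.
apply: filterI; first exact: open_nbhs_nbhs.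
exact: (fc z Uz [set a | a != 0]) (open_nbhs_nbhs (conj (@open_neq _ (0 : R)) fz)).
Qed.

Section PolynomialAlongField.
Context {R : realType} {V : normedModType R}.

Lemma is_derive_horner (p : {poly R}) (f : V -> R) z v d :
  is_derive z v f d -> is_derive z v (fun y => p.[f y]) (p^`().[f z] * d).
Proof.
move=> fd; elim/poly_ind: p => [|p c IH].
  rewrite deriv0 horner0 mul0r (_ : (fun y => _) = fun=> 0).
    exact: is_derive_fct_cst.
  by apply/funext => y; rewrite horner0.
rewrite (_ : (fun y => _) = fun y => p.[f y] * f y + c).
  apply: is_derive_eq (is_derive_fctD (is_derive_fctM IH fd) (is_derive_fct_cst c z v)) _.
  by rewrite derivMXaddC hornerD hornerMX; ring.
by apply/funext => y; rewrite hornerMXaddC.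
Qed.

(** Differentiating [p(f) = 0] along [X] and dividing by ['D_X f] gives [p'(f) = 0]. By induction on
    the size [p' = 0], so [p] is a constant that vanishes at [z0]. *)
Lemma horner_zero_on_poly0 (U : set V) (f : V -> R) (X : V -> V) (p : {poly R}) z0 :
  open U -> (forall z, U z -> derivable f z (X z) /\ 'D_(X z) f z != 0) ->
  U z0 -> (forall z, U z -> p.[f z] = 0) -> p = 0.
Proof.
move=> oU fX Uz0; have [k] := ubnP (size p); elim: k p => // k IH p pk p0.
have p'0 : p^`() = 0.
  have [->|pn0] := eqVneq p 0; first by rewrite deriv0.
  apply: IH; first exact: leq_trans (lt_size_deriv pn0) pk.
  move=> z Uz; have [fd fn0] := fX z Uz.
  have := is_derive_horner p (derivableP fd).
  move=> /(near_eq_is_derive (open_near_eq oU p0 Uz)) [_].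
  by rewrite derive_cst => /esym/eqP; rewrite mulf_eq0 (negPf fn0) orbF => /eqP.
have : (size p <= 1)%N.
  rewrite leqNgt; apply/negP => p1; have := size_poly0 R.
  (* For [size p = s.+2], the coefficient of degree [s] of [p'] is [s.+1] times the leading
     coefficient of [p]. *)
  rewrite -p'0; move: p1; case E : (size p) => [|[|s]]// _ /eqP.
  rewrite size_poly_eq0 => /eqP/polyP/(_ s).
  rewrite coef_deriv coef0 => /eqP; rewrite mulrn_eq0/= => /eqP ps0.
  have : lead_coef p = 0 by rewrite lead_coefE E.
  by move=> /eqP; rewrite lead_coef_eq0 => /eqP pz; rewrite pz size_poly0 in E.
by move=> /size1_polyC pE; move: (p0 _ Uz0); rewrite pE hornerC => ->.
Qed.

End PolynomialAlongField.

Lemma is_derive_eq_on (R : realType) (V W : normedModType R) (U : set V)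
    (f g : V -> W) z v df dg : open U -> U z -> (forall y, U y -> f y = g y) ->
  is_derive z v f df -> is_derive z v g dg -> df = dg.
Proof.
move=> oU Uz fg fd [_ <-]; have [_ <-] := fd.
exact: derive_eq_on fg Uz.
Qed.

Section ShrinkerFrame.
Context {R : realType} (U : set 'rV[R]_2).
Context (x n e1 e2 : 'rV[R]_2 -> 'rV[R]_3) (X1 X2 : 'rV[R]_2 -> 'rV[R]_2).
Context (mu : 'rV[R]_2 -> R) (H al la : R).
Hypothesis F : principal_frame U x n e1 e2 X1 X2 mu H.
Hypothesis al0 : al != 0.
Hypothesis mu0 : forall z, U z -> mu z != 0.
Hypothesis K0 : forall z, U z -> H ^+ 2 - mu z ^+ 2 != 0.
Hypothesis shrink : forall z, U z -> H ^+ 2 - mu z ^+ 2 = al * dot (n z) (x z) + la.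
Variables (m1 m2 : 'rV[R]_2 -> R).
Hypotheses (m1s : smooth_on U m1) (m2s : smooth_on U m2).
Hypothesis mu1 : forall z, U z -> is_derive z (X1 z) mu (m1 z).
Hypothesis mu2 : forall z, U z -> is_derive z (X2 z) mu (m2 z).

Let oU : open U := frame_open F.
Let w1 := frame_w1 e1 e2 X1.
Let w2 := frame_w2 e1 e2 X2.
Let h z := dot (n z) (x z).
Let p1 z := dot (x z) (e1 z).
Let p2 z := dot (x z) (e2 z).

Let k10 z : U z -> H + mu z != 0.
Proof.
by move=> /K0; apply: contraNneq => E; rewrite subr_sqr E mulr0.
Qed.

Let k20 z : U z -> H - mu z != 0.
Proof.
by move=> /K0; apply: contraNneq => E; rewrite subr_sqr E mul0r.
Qed.

Let x1 z : U z -> is_derive z (X1 z) x (e1 z).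
Proof.
by move=> Uz; rewrite -(frame_Dx1 F Uz); exact: smooth_on_is_derive (frame_x F) Uz.
Qed.

Let x2 z : U z -> is_derive z (X2 z) x (e2 z).
Proof.
by move=> Uz; rewrite -(frame_Dx2 F Uz); exact: smooth_on_is_derive (frame_x F) Uz.
Qed.

Let n1 z : U z -> is_derive z (X1 z) n ((- (H + mu z)) *: e1 z).
Proof.
by move=> Uz; rewrite -(frame_Dn1 F Uz); exact: smooth_on_is_derive (frame_n F) Uz.
Qed.

Let n2 z : U z -> is_derive z (X2 z) n ((- (H - mu z)) *: e2 z).
Proof.
by move=> Uz; rewrite -(frame_Dn2 F Uz); exact: smooth_on_is_derive (frame_n F) Uz.
Qed.

Let ne1 z : U z -> dot (n z) (e1 z) = 0.
Proof. by move=> Uz; rewrite dotC (frame_e1n F). Qed.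

Let ne2 z : U z -> dot (n z) (e2 z) = 0.
Proof. by move=> Uz; rewrite dotC (frame_e2n F). Qed.

Let h1 z : U z -> is_derive z (X1 z) h (- (H + mu z) * p1 z).
Proof.
move=> Uz; apply: is_derive_eq (is_derive_dot (n1 Uz) (x1 Uz)) _.
by rewrite dotZl ne1// addr0 (dotC (e1 z)).
Qed.

Let h2 z : U z -> is_derive z (X2 z) h (- (H - mu z) * p2 z).
Proof.
move=> Uz; apply: is_derive_eq (is_derive_dot (n2 Uz) (x2 Uz)) _.
by rewrite dotZl ne2// addr0 (dotC (e2 z)).
Qed.

Let p11 z : U z -> is_derive z (X1 z) p1 (1 + w1 z * p2 z + (H + mu z) * h z).
Proof.
move=> Uz; apply: is_derive_eq (is_derive_dot (x1 Uz) (frame_derive_e11 F Uz)) _.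
by rewrite !dotE (frame_e11 F)// (dotC (x z) (n z)) -/(h z) -/(p2 z) addrA.
Qed.

Let p21 z : U z -> is_derive z (X1 z) p2 (- w1 z * p1 z).
Proof.
move=> Uz; apply: is_derive_eq (is_derive_dot (x1 Uz) (frame_derive_e21 F Uz)) _.
by rewrite !dotE (frame_e12 F)// add0r.
Qed.

Let p22 z : U z -> is_derive z (X2 z) p2 (1 - w2 z * p1 z + (H - mu z) * h z).
Proof.
move=> Uz; apply: is_derive_eq (is_derive_dot (x2 Uz) (frame_derive_e22 F Uz)) _.
by rewrite !dotE (frame_e22 F)// (dotC (x z) (n z)) -/(h z) -/(p1 z) addrA mulNr.
Qed.

Let dcst (c : R) (z v : 'rV[R]_2) : is_derive z v (fun=> c) 0.
Proof. exact: is_derive_fct_cst. Qed.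

Let dK z v m : is_derive z v mu m ->
  is_derive z v (fun y => H ^+ 2 - mu y ^+ 2) (- (2 * mu z * m)).
Proof.
move=> mud; have := is_derive_fctM mud mud => mud2.
rewrite (_ : (fun y => _) = fun y => H ^+ 2 + - (mu y * mu y)); last first.
  by apply/funext => y; rewrite -expr2.
apply: is_derive_eq (is_derive_fctD (dcst (H ^+ 2) z v)
  (is_derive_fctN mud2)) _.
by rewrite add0r; ring.
Qed.

(** The shrinker equation differentiated along [e1]. *)
Let S1 z : U z -> 2 * mu z * m1 z = al * (H + mu z) * p1 z.
Proof.
move=> Uz; have := is_derive_eq_on oU Uz shrink (dK (mu1 Uz))
  (is_derive_fctD (is_derive_fctM (dcst al z (X1 z)) (h1 Uz))
                  (dcst la z _)).
by lra.
Qed.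

Let S2 z : U z -> 2 * mu z * m2 z = al * (H - mu z) * p2 z.
Proof.
move=> Uz; have := is_derive_eq_on oU Uz shrink (dK (mu2 Uz))
  (is_derive_fctD (is_derive_fctM (dcst al z (X2 z)) (h2 Uz))
                  (dcst la z _)).
by lra.
Qed.

Let dmum z v m d a : is_derive z v mu d -> is_derive z v m a ->
  is_derive z v (fun y => 2 * mu y * m y) (2 * (d * m z + mu z * a)).
Proof.
move=> mud ma; apply: is_derive_eq (is_derive_fctM (is_derive_fctM (dcst 2 z v) mud) ma) _.
by ring.
Qed.

(** Derivative of [S1] along [e1]; [S12] and [S22] are those of [S2] along [e1] and [e2]. *)
Let S11 z a : U z -> is_derive z (X1 z) m1 a ->
  2 * (m1 z ^+ 2 + mu z * a) =
  al * (m1 z * p1 z + (H + mu z) * (1 + w1 z * p2 z + (H + mu z) * h z)).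
Proof.
move=> Uz ma; have := is_derive_eq_on oU Uz S1 (dmum (mu1 Uz) ma)
  (is_derive_fctM (is_derive_fctM (dcst al z _) (is_derive_fctD (dcst H z _) (mu1 Uz)))
     (p11 Uz)).
rewrite -expr2 => ->; ring.
Qed.

Let S12 z a : U z -> is_derive z (X1 z) m2 a ->
  2 * (m1 z * m2 z + mu z * a) =
  al * (- m1 z * p2 z - (H - mu z) * w1 z * p1 z).
Proof.
move=> Uz ma; have := is_derive_eq_on oU Uz S2 (dmum (mu1 Uz) ma)
  (is_derive_fctM (is_derive_fctM (dcst al z _)
    (is_derive_fctD (dcst H z _) (is_derive_fctN (mu1 Uz)))) (p21 Uz)).
move=> ->; ring.
Qed.

Let S22 z a : U z -> is_derive z (X2 z) m2 a ->
  2 * (m2 z ^+ 2 + mu z * a) =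
  al * (- m2 z * p2 z + (H - mu z) * (1 - w2 z * p1 z + (H - mu z) * h z)).
Proof.
move=> Uz ma; have := is_derive_eq_on oU Uz S2 (dmum (mu2 Uz) ma)
  (is_derive_fctM (is_derive_fctM (dcst al z _)
    (is_derive_fctD (dcst H z _) (is_derive_fctN (mu2 Uz)))) (p22 Uz)).
rewrite -expr2 => ->; ring.
Qed.

Let C1 z : U z -> 2 * mu z * w1 z = m2 z.
Proof. by move=> Uz; have [] := frame_codazzi F Uz (mu1 Uz) (mu2 Uz). Qed.

Let C2 z : U z -> 2 * mu z * w2 z = - m1 z.
Proof. by move=> Uz; have [] := frame_codazzi F Uz (mu1 Uz) (mu2 Uz). Qed.

Let ex_is_derive (f : 'rV[R]_2 -> R) z v : smooth_on U f -> U z ->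
  exists a, is_derive z v f a.
Proof. by move=> fs Uz; eexists; exact: smooth_on_is_derive fs Uz. Qed.

Let W t := al * H + (H ^+ 2 - t ^+ 2) ^+ 2 - la * (H ^+ 2 + t ^+ 2).

Let gradient_identity z : U z -> 2 * (m1 z ^+ 2 + m2 z ^+ 2) = W (mu z).
Proof.
move=> Uz.
have [a11 d11] := ex_is_derive (X1 z) m1s Uz.
have [a22 d22] := ex_is_derive (X2 z) m2s Uz.
have [b12 dw2] := ex_is_derive (X1 z) (smooth_on_w2 F) Uz.
have [b21 dw1] := ex_is_derive (X2 z) (smooth_on_w1 F) Uz.
have C1' := is_derive_eq_on oU Uz C1 (dmum (mu2 Uz) dw1) d22.
have C2' := is_derive_eq_on oU Uz C2 (dmum (mu1 Uz) dw2) (is_derive_fctN d11).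
exact: (shrinker_gradient_identity al0 (mu0 Uz) (k10 Uz) (k20 Uz) (shrink Uz)
  (C1 Uz) (C2 Uz) (S1 Uz) (S2 Uz) (S11 Uz d11) (S22 Uz d22) C1' C2'
  (frame_gauss F Uz dw2 dw1)).
Qed.

Let quintic t :=
  (H + t) * t * (- 4 * t * (H ^+ 2 - t ^+ 2) - 2 * la * t) + 2 * H * W t
  - 2 * (H + t) ^+ 2 * (al + (H + t) * (H ^+ 2 - t ^+ 2 - la)).

Let gradient_derived z : U z -> m1 z * quintic (mu z) = 0.
Proof.
move=> Uz.
have [a11 d11] := ex_is_derive (X1 z) m1s Uz.
have [a12 d12] := ex_is_derive (X1 z) m2s Uz.
have B : 4 * (m1 z * a11 + m2 z * a12) =
    (- 4 * mu z * (H ^+ 2 - mu z ^+ 2) - 2 * la * mu z) * m1 z.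
  (* The right side is rewritten through K, using [H^2 + mu^2 = 2 H^2 - K], so that [dK] supplies
     its derivative. *)
  have E y : U y -> 2 * (m1 y * m1 y + m2 y * m2 y) =
      (al * H - la * (H ^+ 2 + H ^+ 2)) + ((H ^+ 2 - mu y ^+ 2)
      * (H ^+ 2 - mu y ^+ 2) + la * (H ^+ 2 - mu y ^+ 2)).
    by move=> Uy; rewrite -!expr2 gradient_identity// /W; ring.
  have dKz := dK (mu1 Uz).
  have := is_derive_eq_on oU Uz E
    (is_derive_fctM (dcst 2 z _)
       (is_derive_fctD (is_derive_fctM d11 d11) (is_derive_fctM d12 d12)))
    (is_derive_fctD (dcst _ z _)
       (is_derive_fctD (is_derive_fctM dKz dKz)
          (is_derive_fctM (dcst la z _) dKz))).
  by lra.
exact: (shrinker_gradient_derived al0 (mu0 Uz) (k10 Uz) (k20 Uz) (shrink Uz)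
  (C1 Uz) (S1 Uz) (S2 Uz) (S11 Uz d11) (S12 Uz d12) (gradient_identity Uz) B).
Qed.

(** On the open set where [m1] is nonzero, [mu] has a nonzero derivative along [X1] and [quintic]
    vanishes along [mu]; if that set were nonempty, the formal polynomial [P] would be zero. *)
Lemma shrinker_derive_mu_eq0 z : U z -> m1 z = 0.
Proof.
move=> Uz; apply/eqP/negPn/negP => m1z.
pose P : {poly R} := (H%:P + 'X) * 'X * (- (4%:P * 'X * ((H ^+ 2)%:P - 'X * 'X))
     - (2 * la)%:P * 'X)
  + (2 * H)%:P * ((al * H)%:P + ((H ^+ 2)%:P - 'X * 'X) * ((H ^+ 2)%:P - 'X * 'X)
       - la%:P * ((H ^+ 2)%:P + 'X * 'X))
  - 2%:P * (H%:P + 'X) * (H%:P + 'X) * (al%:P + (H%:P + 'X) *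
       ((H ^+ 2)%:P - 'X * 'X - la%:P)).
have PE t : P.[t] = quintic t.
  by rewrite /P !(hornerD, hornerN, hornerM, hornerX, hornerC) /quintic /W; ring.
have oU' : open [set y | U y /\ m1 y != 0].
  by apply: open_neq0 => // y Uy; exact: smooth_on_continuous m1s Uy.
have P0 : P = 0.
  apply: (@horner_zero_on_poly0 _ _ _ mu X1 P z oU') => //.
    by move=> y [Uy m1y]; have [? ->] := mu1 Uy.
  move=> y [Uy m1y]; rewrite PE.
  by have /eqP := gradient_derived Uy; rewrite mulf_eq0 (negPf m1y) => /eqP.
have Q0 t : quintic t = 0 by rewrite -PE P0 horner0.
(* the fifth difference of the quintic is 5! times its leading coefficient 6 *)
have : quintic 5 - 5 * quintic 4 + 10 * quintic 3 - 10 * quintic 2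
    + 5 * quintic 1 - quintic 0 = 720 by rewrite /quintic /W; ring.
by rewrite !Q0 => /eqP; rewrite !mulr0 !subr0 !addr0 eq_sym pnatr_eq0.
Qed.

End ShrinkerFrame.

(** * Existence of principal frames *)
Lemma derive_comm_row (R : realType) m n (U : set 'rV[R]_m) (f : 'rV[R]_m -> 'rV[R]_n)
    (z u v : 'rV[R]_m) :
  open U -> smooth_on U f -> U z -> 'D_u ('D_v f) z = 'D_v ('D_u f) z.
Proof.
move=> oU fs Uz; have /smooth_on_rowP fj := fs.
have E u' v' j : ('D_u' ('D_v' f) z) 0 j = 'D_u' ('D_v' (fun y => f y 0 j)) z.
  have Dd := smooth_on_is_derive u' (smooth_on_derive v' fs) Uz.
  apply: etrans (derive_entry j (@ex_derive _ _ _ _ _ _ _ Dd)) _.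
  apply: derive_eq_on Uz => // y Uy; apply: derive_entry.
  exact: (@ex_derive _ _ _ _ _ _ _ (smooth_on_is_derive v' fs Uy)).
apply/rowP => j; apply: etrans (E u v j) (etrans _ (esym (E v u j))).
exact: derive_comm (fj oU j) Uz.
Qed.

Section Mat2.
Context {R : realType}.
Implicit Type A : 'M[R]_2.

Lemma mxtrace2 A : \tr A = A 0 0 + A 1 1.
Proof. by rewrite /mxtrace !big_ord_recl big_ord0 addr0; congr (A _ _ + A _ _); apply/val_inj. Qed.

Lemma det2 A : \det A = A 0 0 * A 1 1 - A 0 1 * A 1 0.
Proof.
rewrite (expand_det_row _ 0) !big_ord_recl big_ord0 addr0 /cofactor !det_mx11 !mxE /=.
have -> : lift ord0 ord0 = 1 :> 'I_2 by apply/val_inj.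
have -> : lift 1 0 = 0 :> 'I_2 by apply/val_inj.
by rewrite /= !addn0 expr0 expr1; ring.
Qed.

Lemma cayley_hamilton2 A (a b : R) : a + b = \tr A -> a * b = \det A ->
  (A - a%:M) *m (A - b%:M) = 0.
Proof.
rewrite mxtrace2 det2 => ab ab'; apply/matrixP => i j.
rewrite !mxE !big_ord_recl big_ord0 !mxE.
have -> : lift ord0 ord0 = 1 :> 'I_2 by apply/val_inj.
have i01 (k : 'I_2) : k = 0 \/ k = 1.
  by case: k => [[|[|//]] ?]; [left|right]; apply/val_inj.
have bE : b = A 0 0 + A 1 1 - a by lra.
case: (i01 i) => ->; case: (i01 j) => ->; rewrite /= ?mulr1n ?mulr0n bE.
- have : a * (A 0 0 + A 1 1 - a) = A 0 0 * A 1 1 - A 0 1 * A 1 0 by rewrite -bE.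
  nra.
- ring.
- ring.
- have : a * (A 0 0 + A 1 1 - a) = A 0 0 * A 1 1 - A 0 1 * A 1 0 by rewrite -bE.
  nra.
Qed.

Lemma mx_neq0_mulmx m n (A : 'M[R]_(m, n)) : A != 0 -> exists u : 'rV_m, u *m A != 0.
Proof.
move=> /eqP A0; apply: contrapT => /forallNP u0; apply: A0.
by apply/row_matrixP => i; rewrite row0 rowE; apply/eqP/negPn/negP/u0.
Qed.

End Mat2.

Lemma gram_eq0 (R : realType) m (A B : 'rV[R]_m) :
  dot A A * dot B B - dot A B ^+ 2 = 0 -> dot B B *: A - dot A B *: B = 0.
Proof.
move=> AB; apply/eqP; rewrite -dot_eq0 !dotE (dotC B A); apply/eqP.
transitivity (dot B B * (dot A A * dot B B - dot A B ^+ 2)); first by ring.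
by rewrite AB mulr0.
Qed.

(** Cramer's rule for the Gram matrix of [A] and [B] writes both coefficients as quotients of smooth
    functions. *)
Lemma smooth_on_coefficients (R : realType) (V : normedModType R) m (U : set V)
    (A B f : V -> 'rV[R]_m) (a b : V -> R) :
  open U -> smooth_on U A -> smooth_on U B -> smooth_on U f ->
  (forall z, U z -> dot (A z) (A z) * dot (B z) (B z) - dot (A z) (B z) ^+ 2 != 0) ->
  (forall z, U z -> f z = a z *: A z + b z *: B z) ->
  smooth_on U a /\ smooth_on U b.
Proof.
move=> oU As Bs fs g0 fE.
have dots (p q : V -> 'rV[R]_m) : smooth_on U p -> smooth_on U q ->
  smooth_on U (fun z => dot (p z) (q z)) by move=> ? ?; exact: smooth_on_dot.
pose gram z := dot (A z) (A z) * dot (B z) (B z) - dot (A z) (B z) * dot (A z) (B z).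
have gram0 z : U z -> gram z != 0 by move=> Uz; have := g0 z Uz.
have gs : smooth_on U (fun z => (gram z)^-1).
  apply: smooth_onV => //; apply: smooth_onB => //;
    by apply: smooth_onM => //; exact: dots.
split.
  apply: (@smooth_on_eq _ _ _ U (fun z => (dot (f z) (A z) * dot (B z) (B z)
     - dot (f z) (B z) * dot (A z) (B z)) * (gram z)^-1)) => //.
    move=> z Uz; apply: (canLR (mulfK (gram0 z Uz))).
    by rewrite fE// !dotE (dotC (B z) (A z)) /gram; ring.
  apply: smooth_onM => //; apply: smooth_onB => //;
    by apply: smooth_onM => //; exact: dots.
apply: (@smooth_on_eq _ _ _ U (fun z => (dot (f z) (B z) * dot (A z) (A z)
   - dot (f z) (A z) * dot (A z) (B z)) * (gram z)^-1)) => //.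
  move=> z Uz; apply: (canLR (mulfK (gram0 z Uz))).
  by rewrite fE// !dotE (dotC (B z) (A z)) /gram; ring.
apply: smooth_onM => //; apply: smooth_onB => //;
  by apply: smooth_onM => //; exact: dots.
Qed.

(** * Principal frames of a parametrized surface *)

Section LocalSurface.
Context {R : realType} (U : set 'rV[R]_2).
Context (x n : 'rV[R]_2 -> 'rV[R]_3) (S : 'rV[R]_2 -> 'M[R]_2) (H : R).
Implicit Types z u v w : 'rV[R]_2.
Hypothesis oU : open U.
Hypothesis xs : smooth_on U x.
Hypothesis ns : smooth_on U n.
Hypothesis inj : forall z v, U z -> 'D_v x z = 0 -> v = 0.
Hypothesis orth : forall z v, U z -> dot ('D_v x z) (n z) = 0.
Hypothesis unit : forall z, U z -> dot (n z) (n z) = 1.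
Hypothesis nS : forall z v, U z -> 'D_v n z = - 'D_(v *m S z) x z.
Hypothesis trS : forall z, U z -> \tr (S z) = 2 * H.

Let xd z : U z -> differentiable x z.
Proof. exact: smooth_on_differentiable. Qed.

(** Differentiate [<D_v x, n> = 0] along [u] and use the symmetry of [D_u D_v x]. *)
Lemma normal_self_adjoint z u v : U z ->
  dot ('D_u n z) ('D_v x z) = dot ('D_v n z) ('D_u x z).
Proof.
move=> Uz.
have E u' v' : dot ('D_u' ('D_v' x) z) (n z) + dot ('D_v' x z) ('D_u' n z) = 0.
  have := is_derive_eq_on oU Uz (fun y Uy => orth v' Uy)
    (is_derive_dot (smooth_on_is_derive u' (smooth_on_derive v' xs) Uz)
      (smooth_on_is_derive u' ns Uz)) (is_derive_fct_cst 0 z u').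
  by [].
have alg (a a' b c p q w : 'rV[R]_3) : a = a' -> dot a w + dot b p = 0 ->
    dot a' w + dot c q = 0 -> dot p b = dot q c.
  by move=> -> E1 E2; rewrite (dotC p) (dotC q); lra.
exact: alg (derive_comm_row u v oU xs Uz) (E u v) (E v u).
Qed.

Lemma shape_self_adjoint z u v (a : R) : U z ->
  dot ('D_(u *m (S z - a%:M)) x z) ('D_v x z) =
  dot ('D_u x z) ('D_(v *m (S z - a%:M)) x z).
Proof.
move=> Uz; have E w : 'D_(w *m (S z - a%:M)) x z = - 'D_w n z - a *: 'D_w x z.
  rewrite mulmxBr mul_mx_scalar (deriveBl _ _ (xd Uz)) nS// opprK.
  have := derive_comb a 0 w 0 (xd Uz).
  by rewrite scaler0 addr0 scale0r addr0 => ->.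
have alg (p q b c : 'rV[R]_3) : dot p b = dot q c ->
    dot (- p - a *: c) b = dot c (- q - a *: b).
  by move=> pq; rewrite !dotE (dotC c q) pq.
rewrite (E u) (E v); exact: alg (normal_self_adjoint u v Uz).
Qed.

Let b0 : 'rV[R]_2 := delta_mx 0 0.
Let b1 : 'rV[R]_2 := delta_mx 0 1.

Let b01 (a b : R) : a *: b0 + b *: b1 = 0 -> a = 0 /\ b = 0.
Proof.
move=> /rowP E; have := E 0; have := E 1; rewrite !mxE /=.
by rewrite !mulr1 !mulr0 addr0 add0r.
Qed.

Let vE v : v = v 0 0 *: b0 + v 0 1 *: b1.
Proof.
rewrite [LHS]row_sum_delta !big_ord_recl big_ord0 addr0.
by have -> : lift ord0 ord0 = 1 :> 'I_2 by apply/val_inj.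
Qed.

Let gram z := dot ('D_b0 x z) ('D_b0 x z) * dot ('D_b1 x z) ('D_b1 x z)
  - dot ('D_b0 x z) ('D_b1 x z) ^+ 2.

Let gram_neq0 z : U z -> gram z != 0.
Proof.
move=> Uz; apply/eqP => g0.
have w0 := gram_eq0 g0.
have : dot ('D_b1 x z) ('D_b1 x z) *: b0
    + (- dot ('D_b0 x z) ('D_b1 x z)) *: b1 = 0.
  by apply: (inj Uz); rewrite (derive_comb _ _ _ _ (xd Uz)) scaleNr.
move=> /b01[/eqP]; rewrite dot_eq0 => /eqP /(inj Uz) B0 _.
have [|_ /eqP] := @b01 0 1; first by rewrite B0 scale0r scaler0 addr0.
by rewrite oner_eq0.
Qed.

Lemma smooth_on_tangent_preimage (f : 'rV[R]_2 -> 'rV[R]_3) (Y : 'rV[R]_2 -> 'rV[R]_2) :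
  smooth_on U f -> (forall z, U z -> 'D_(Y z) x z = f z) -> smooth_on U Y.
Proof.
move=> fs Yf.
have fE z : U z -> f z = Y z 0 0 *: 'D_b0 x z + Y z 0 1 *: 'D_b1 x z.
  move=> Uz; rewrite -(Yf z Uz) [in LHS](vE (Y z)).
  exact: derive_comb (xd Uz).
have [Y0 Y1] := smooth_on_coefficients oU (smooth_on_derive b0 xs)
  (smooth_on_derive b1 xs) fs gram_neq0 fE.
apply/smooth_on_rowP => // -[[|[|//]] j2].
  by rewrite (_ : Ordinal j2 = 0)//; apply/val_inj.
by rewrite (_ : Ordinal j2 = 1)//; apply/val_inj.
Qed.

Section FrameExistence.
Variable mu : 'rV[R]_2 -> R.
Hypothesis mus : smooth_on U mu.
Hypothesis mu0 : forall z, U z -> mu z != 0.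
Hypothesis detS : forall z, U z -> \det (S z) = H ^+ 2 - mu z ^+ 2.

(** Otherwise [S z] would be scalar with trace [2 H + 2 s mu], which differs from [2 H]. *)
Let shift_neq0 z (s : R) : U z -> s ^+ 2 = 1 -> S z - (H + s * mu z)%:M != 0.
Proof.
move=> Uz s1; apply/eqP => /eqP; rewrite subr_eq0 => /eqP SE.
have := trS Uz; rewrite SE mxtrace_scalar => /eqP; apply/negP.
rewrite -subr_eq0 (_ : _ - _ = 2 * (s * mu z)); last by rewrite -mulr_natl; ring.
rewrite !mulf_neq0 ?mu0//; apply/eqP => s0; move: s1.
by rewrite s0 expr0n => /esym/eqP; rewrite oner_eq0.
Qed.

(** The sign [s] treats both curvatures at once. By Cayley-Hamilton the row [u (S - (H - s mu))] is
    an eigenvector for [H + s mu]; its image [f] is a smooth combination of [D_u n] and [D_u x]. *)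
Let field_existence z0 (s : R) : U z0 -> s ^+ 2 = 1 ->
  exists u (f : 'rV[R]_2 -> 'rV[R]_3) (Y : 'rV[R]_2 -> 'rV[R]_2),
  [/\ smooth_on U f, smooth_on U Y, f z0 != 0,
   (forall z, U z -> 'D_(Y z) x z = f z) &
   (forall z, U z -> 'D_(Y z) n z = (- (H + s * mu z)) *: f z) /\
   (forall z, Y z = u *m (S z - (H - s * mu z)%:M))].
Proof.
move=> Uz0 s1.
have s1' : (- s) ^+ 2 = 1 by rewrite sqrrN.
have [u u0] := mx_neq0_mulmx (shift_neq0 Uz0 s1'); rewrite mulNr in u0.
pose Y z := u *m (S z - (H - s * mu z)%:M).
pose f z := (-1) *: 'D_u n z + (- (H - s * mu z)) *: 'D_u x z.
have fs : smooth_on U f.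
  apply: smooth_onD => //; apply: smooth_onZ => //; try exact: smooth_on_derive.
    exact: smooth_on_cst.
  apply: smooth_onN => //; apply: smooth_onB => //; first exact: smooth_on_cst.
  by apply: smooth_onM => //; exact: smooth_on_cst.
have Yf z : U z -> 'D_(Y z) x z = f z.
  move=> Uz; rewrite /Y mulmxBr mul_mx_scalar (deriveBl _ _ (xd Uz)) /f nS//.
  have := derive_comb (H - s * mu z) 0 u 0 (xd Uz).
  by rewrite scaler0 addr0 scale0r addr0 => ->; rewrite scaleN1r opprK scaleNr.
exists u, f, Y; split => //.
- exact: smooth_on_tangent_preimage Yf.
- by apply: contra_neq u0 => f0; apply: (inj Uz0); rewrite -[RHS]f0; exact: Yf.
split=> // z Uz; rewrite nS// -Yf//.
have : Y z *m (S z - (H + s * mu z)%:M) = 0.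
  rewrite /Y -mulmxA cayley_hamilton2 ?mulmx0//; first by rewrite trS//; ring.
  rewrite detS//; transitivity (H ^+ 2 - s ^+ 2 * mu z ^+ 2); first by ring.
  by rewrite s1 mul1r.
move=> /eqP; rewrite mulmxBr subr_eq0 => /eqP ->.
rewrite mul_mx_scalar scaleNr; congr (- _).
have := derive_comb (H + s * mu z) 0 (Y z) 0 (xd Uz).
by rewrite scaler0 addr0 scale0r addr0.
Qed.

Lemma principal_frame_existence z0 : U z0 ->
  exists V e1 e2 X1 X2, [/\ V `<=` U, V z0 &
    principal_frame V x n e1 e2 X1 X2 mu H].
Proof.
move=> Uz0.
have s1 : (1 : R) ^+ 2 = 1 by rewrite expr1n.
have s2 : (-1 : R) ^+ 2 = 1 by rewrite sqrrN expr1n.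
have [u1 [f1 [Y1 [f1s Y1s f10 Y1f [Y1n Y1E]]]]] := field_existence Uz0 s1.
have [u2 [f2 [Y2 [f2s Y2s f20 Y2f [Y2n Y2E]]]]] := field_existence Uz0 s2.
(* [u1] and [u2] are adapted to [z0] only, so [f1] or [f2] may vanish elsewhere in [U]. *)
pose V1 := [set z | U z /\ dot (f1 z) (f1 z) != 0].
pose V := [set z | V1 z /\ dot (f2 z) (f2 z) != 0].
have VU : V `<=` U by move=> z [[]].
have q1s : smooth_on U (fun z => dot (f1 z) (f1 z)) by exact: smooth_on_dot.
have q2s : smooth_on U (fun z => dot (f2 z) (f2 z)) by exact: smooth_on_dot.
have oV : open V.
  apply: open_neq0; last by move=> z [Uz _]; exact: smooth_on_continuous q2s Uz.
  by apply: open_neq0 => // z Uz; exact: smooth_on_continuous q1s Uz.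
(* Self-adjointness moves the factor [S - (H - mu)] onto the second argument, where it meets
   [S - (H + mu)]; the product is zero by Cayley-Hamilton. *)
have f12 z : U z -> dot (f1 z) (f2 z) = 0.
  move=> Uz; rewrite -Y1f// -Y2f// Y1E Y2E.
  rewrite shape_self_adjoint// -mulmxA cayley_hamilton2.
  - by rewrite mulmx0 derive0 dot0r.
  - by rewrite trS//; ring.
  - by rewrite detS//; ring.
have pos f z : dot (f z : 'rV[R]_3) (f z) != 0 -> 0 < dot (f z) (f z).
  by rewrite dot_eq0; exact: dot_gt0.
have norm1 f z : dot (f z : 'rV[R]_3) (f z) != 0 ->
    (Num.sqrt (dot (f z) (f z)))^-1 * ((Num.sqrt (dot (f z) (f z)))^-1 *
    dot (f z) (f z)) = 1.
  move=> fz; rewrite -{3}[dot (f z) (f z)]sqr_sqrtr ?dot_ge0//.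
  have r0 : Num.sqrt (dot (f z) (f z)) != 0 by rewrite gt_eqF// sqrtr_gt0 pos.
  by field.
pose r1 z := (Num.sqrt (dot (f1 z) (f1 z)))^-1.
pose r2 z := (Num.sqrt (dot (f2 z) (f2 z)))^-1.
have rs f : smooth_on V (fun z => dot (f z : 'rV[R]_3) (f z)) ->
    (forall z, V z -> dot (f z) (f z) != 0) ->
    smooth_on V (fun z => (Num.sqrt (dot (f z) (f z)))^-1).
  move=> fs f0; apply: smooth_onV => //.
    by move=> z Vz; rewrite gt_eqF// sqrtr_gt0 pos// f0.
  by apply: smooth_on_sqrt => // z Vz; rewrite pos// f0.
have sub (W : normedModType R) (f : 'rV[R]_2 -> W) : smooth_on U f -> smooth_on V f.
  exact: smooth_on_sub.
have r1s : smooth_on V r1 by apply: rs; [exact: sub|move=> z [[]]].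
have r2s : smooth_on V r2 by apply: rs; [exact: sub|move=> z []].
have DZ (W : normedModType R) (f : 'rV[R]_2 -> W) (a : R) z v :
    differentiable f z -> 'D_(a *: v) f z = a *: 'D_v f z.
  by move=> fd; have := derive_comb a 0 v 0 fd; rewrite scaler0 addr0 scale0r addr0.
have nd z : U z -> differentiable n z by exact: smooth_on_differentiable.
exists V, (fun z => r1 z *: f1 z), (fun z => r2 z *: f2 z),
  (fun z => r1 z *: Y1 z), (fun z => r2 z *: Y2 z); split=> //.
  by split; [split|]; rewrite ?dot_eq0.
split=> //; try exact: sub; try by apply: smooth_onZ => //; exact: sub.
- by move=> z v /VU; exact: inj.
- by move=> z /VU Uz; rewrite DZ ?Y1f//; exact: xd.
- by move=> z /VU Uz; rewrite DZ ?Y2f//; exact: xd.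
- move=> z /VU Uz; rewrite DZ ?Y1n//; last exact: nd.
  by rewrite mul1r !scalerA mulrC.
- move=> z /VU Uz; rewrite DZ ?Y2n//; last exact: nd.
  by rewrite mulN1r !scalerA mulrC.
- by move=> z [[_ z1] _]; rewrite !dotE norm1.
- by move=> z [_ z2]; rewrite !dotE norm1.
- by move=> z /VU; exact: unit.
- by move=> z /VU Uz; rewrite !dotE f12// !mulr0.
- by move=> z /VU Uz; rewrite dotZl -Y1f// orth// mulr0.
- by move=> z /VU Uz; rewrite dotZl -Y2f// orth// mulr0.
Qed.

End FrameExistence.
End LocalSurface.

(** * Local consequences of the shrinker equation *)
Section FrameSpan.
Context {R : realType} (U : set 'rV[R]_2).
Context (x n e1 e2 : 'rV[R]_2 -> 'rV[R]_3) (X1 X2 : 'rV[R]_2 -> 'rV[R]_2).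
Context (mu : 'rV[R]_2 -> R) (H : R).
Hypothesis F : principal_frame U x n e1 e2 X1 X2 mu H.
Hypothesis orth : forall z v, U z -> dot ('D_v x z) (n z) = 0.

Lemma principal_frame_expand z (a : 'rV[R]_3) : U z ->
  a = dot a (e1 z) *: e1 z + dot a (e2 z) *: e2 z + dot a (n z) *: n z.
Proof. by case: F => *; apply: orthonormal_expansion; eauto. Qed.

Lemma principal_frame_span z v : U z -> exists a b, v = a *: X1 z + b *: X2 z.
Proof.
move=> Uz; have xd := smooth_on_differentiable (frame_x F) Uz.
exists (dot ('D_v x z) (e1 z)), (dot ('D_v x z) (e2 z)).
apply/eqP; rewrite -subr_eq0; apply/eqP/(frame_inj F Uz).
rewrite (deriveBl _ _ xd) (derive_comb _ _ _ _ xd) (frame_Dx1 F Uz) (frame_Dx2 F Uz).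
have := principal_frame_expand ('D_v x z) Uz.
by rewrite orth// scale0r addr0 => E; apply/eqP; rewrite subr_eq0; apply/eqP.
Qed.

Lemma principal_frame_derive0 (W : normedModType R) (f : 'rV[R]_2 -> W) z v :
  U z -> differentiable f z -> 'D_(X1 z) f z = 0 -> 'D_(X2 z) f z = 0 ->
  'D_v f z = 0.
Proof.
move=> Uz fd f1 f2; have [a [b ->]] := principal_frame_span v Uz.
by rewrite (derive_comb _ _ _ _ fd) f1 f2 !scaler0 addr0.
Qed.

End FrameSpan.

Section LocalShrinker.
Context {R : realType} (U : set 'rV[R]_2).
Context (x n : 'rV[R]_2 -> 'rV[R]_3) (S : 'rV[R]_2 -> 'M[R]_2) (H al la : R).
Implicit Types z u v w : 'rV[R]_2.
Hypothesis oU : open U.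
Hypothesis xs : smooth_on U x.
Hypothesis ns : smooth_on U n.
Hypothesis inj : forall z v, U z -> 'D_v x z = 0 -> v = 0.
Hypothesis orth : forall z v, U z -> dot ('D_v x z) (n z) = 0.
Hypothesis unit : forall z, U z -> dot (n z) (n z) = 1.
Hypothesis nS : forall z v, U z -> 'D_v n z = - 'D_(v *m S z) x z.
Hypothesis trS : forall z, U z -> \tr (S z) = 2 * H.
Hypothesis al0 : al != 0.
Hypothesis shrink : forall z, U z -> \det (S z) = al * dot (n z) (x z) + la.
Hypothesis detS_le : forall z, U z -> \det (S z) <= H ^+ 2.

Let h z := dot (n z) (x z).
Let K z := al * h z + la.

Let hs : smooth_on U h. Proof. exact: smooth_on_dot. Qed.

Let Ks : smooth_on U K.
Proof.
apply: smooth_onD => //; last exact: smooth_on_cst.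
by apply: smooth_onM => //; exact: smooth_on_cst.
Qed.

(* Off the zeros of K and the umbilics, K = H^2 - mu^2 with mu smooth. *)
Let derive_K_generic z v : U z -> K z != 0 -> H ^+ 2 - K z != 0 -> 'D_v K z = 0.
Proof.
move=> Uz Kz HKz.
pose V1 := [set y | U y /\ K y != 0].
pose V := [set y | V1 y /\ H ^+ 2 - K y != 0].
have VU : V `<=` U by move=> y [[]].
have HKs : smooth_on U (fun y => H ^+ 2 - K y).
  by apply: smooth_onB => //; exact: smooth_on_cst.
have oV : open V.
  apply: open_neq0; last by move=> y [Uy _]; exact: smooth_on_continuous HKs Uy.
  by apply: open_neq0 => // y Uy; exact: smooth_on_continuous Ks Uy.
have HK0 y : V y -> 0 < H ^+ 2 - K y.
  by move=> [[Uy _] HK]; rewrite lt_def HK subr_ge0 -(shrink Uy : _ = K y) detS_le.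
pose mu y := Num.sqrt (H ^+ 2 - K y).
have mus : smooth_on V mu by apply: smooth_on_sqrt => //; exact: smooth_on_sub HKs.
have muE y : V y -> K y = H ^+ 2 - mu y ^+ 2.
  by move=> Vy; rewrite sqr_sqrtr ?ltW ?HK0//; ring.
have mu0 y : V y -> mu y != 0 by move=> Vy; rewrite gt_eqF// sqrtr_gt0 HK0.
have Vz : V z by split; [split|].
have [V' [e1 [e2 [X1 [X2 [V'V V'z F]]]]]] := @principal_frame_existence R V x n S H
  oV (smooth_on_sub VU xs) (smooth_on_sub VU ns) (fun z v Vz => inj (VU _ Vz))
  (fun z v Vz => orth v (VU _ Vz)) (fun z Vz => unit (VU _ Vz))
  (fun z v Vz => nS v (VU _ Vz)) (fun z Vz => trS (VU _ Vz)) mu mus mu0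
  (fun z Vz => etrans (shrink (VU _ Vz)) (muE _ Vz)) z Vz.
have oV' := frame_open F.
have K0' y : V' y -> H ^+ 2 - mu y ^+ 2 != 0.
  by move=> /V'V Vy; rewrite -muE//; case: Vy => [[]].
have shr y : V' y -> H ^+ 2 - mu y ^+ 2 = al * dot (n y) (x y) + la.
  by move=> /V'V Vy; rewrite -muE.
pose m1 y := 'D_(X1 y) mu y; pose m2 y := 'D_(X2 y) mu y.
have m1s : smooth_on V' m1.
  exact: smooth_on_derive_field_scalar oV' _ _ (frame_X1 F) (frame_mu F).
have m2s : smooth_on V' m2.
  exact: smooth_on_derive_field_scalar oV' _ _ (frame_X2 F) (frame_mu F).
have mud v' y : V' y -> is_derive y v' mu ('D_v' mu y).
  by move=> V'y; exact: smooth_on_is_derive (frame_mu F) V'y.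
have m10 : m1 z = 0.
  by apply: (shrinker_derive_mu_eq0 F al0 _ K0' shr m1s m2s) => // y /V'V /mu0.
(* The swapped frame, in which [mu, m1, m2] become [- mu, - m2, - m1]. *)
have m20 : m2 z = 0.
  apply: oppr_inj; rewrite oppr0.
  apply: (shrinker_derive_mu_eq0 (principal_frame_swap F) al0 _ _ _
    (m1 := fun y => - m2 y) (m2 := fun y => - m1 y)) => //.
  - by move=> y /V'V /mu0; rewrite oppr_eq0.
  - by move=> y V'y; rewrite sqrrN K0'.
  - by move=> y V'y; rewrite sqrrN shr.
  - exact: smooth_onN oV' m2s.
  - exact: smooth_onN oV' m1s.
  - by move=> y V'y; apply: is_derive_fctN; exact: mud.
  - by move=> y V'y; apply: is_derive_fctN; exact: mud.
have orth' y v' : V' y -> dot ('D_v' x y) (n y) = 0.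
  by move=> /V'V /VU; exact: orth.
have mudf : differentiable mu z by exact: smooth_on_differentiable (frame_mu F) V'z.
have mv : 'D_v mu z = 0.
  have m10' : 'D_(X1 z) mu z = 0 := m10.
  have m20' : 'D_(X2 z) mu z = 0 := m20.
  exact: (principal_frame_derive0 F orth' v V'z mudf m10' m20').
have Kd := smooth_on_is_derive v Ks Uz.
have mud0 : is_derive z v mu 0 by rewrite -mv; exact: mud.
have E y : V' y -> K y = H ^+ 2 + - (mu y * mu y).
  by move=> /V'V Vy; rewrite muE// expr2.
have := is_derive_eq_on oV' V'z E Kd (is_derive_fctD
  (is_derive_fct_cst (H ^+ 2) z v) (is_derive_fctN (is_derive_fctM mud0 mud0))).
by move=> ->; rewrite !mulr0 addr0 oppr0 addr0.
Qed.

(** If ['D_v K z] is nonzero, it is so on an open set; by the generic case K takes only the values 0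
    and [H^2] there. [K0], its derivative [K1] and the derivative of [K1] then contradict
    ['D_v K z != 0], so no density of generic points is required. *)
Lemma shrinker_support_derive0 z v : U z ->
  'D_v (fun y => dot (n y) (x y)) z = 0.
Proof.
rewrite -/h => Uz; have DKE y : U y -> 'D_v K y = al * 'D_v h y.
  move=> Uy; have hd := smooth_on_is_derive v hs Uy.
  have := is_derive_fctD (is_derive_fctM (is_derive_fct_cst al y v) hd)
    (is_derive_fct_cst la y v).
  by move=> [_]; rewrite mulr0 !addr0.
suff DK0 : 'D_v K z = 0.
  by have := DKE z Uz; rewrite DK0 => /esym/eqP; rewrite mulf_eq0 (negPf al0) => /eqP.
apply/eqP/negPn/negP => DKz.
pose V := [set y | U y /\ 'D_v K y != 0].
have oV : open V.
  apply: open_neq0 => // y Uy; apply: smooth_on_continuous Uy.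
  exact: smooth_on_derive.
have VU y : V y -> U y by case.
have Kd y : V y -> is_derive y v K ('D_v K y).
  by move=> /VU; exact: smooth_on_is_derive Ks.
have c (a : R) y : is_derive y v (fun=> a) 0 by exact: is_derive_fct_cst.
have K0 y : V y -> K y * (K y + - H ^+ 2) = 0.
  move=> Vy; have [->|Ky] := eqVneq (K y) 0; first by rewrite mul0r.
  have [HK|HK] := eqVneq (H ^+ 2 - K y) 0.
    by rewrite (_ : K y + _ = 0) ?mulr0//; move: HK => /eqP; rewrite subr_eq0 => /eqP ->; rewrite subrr.
  by have [Uy] := Vy; rewrite (derive_K_generic v Uy Ky HK) eqxx.
have K1 y : V y -> K y + (K y + - H ^+ 2) = 0.
  move=> Vy; have [_ DK] := Vy.
  have := is_derive_eq_on oV Vy K0 (is_derive_fctM (Kd y Vy)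
     (is_derive_fctD (Kd y Vy) (c _ y))) (c 0 y).
  by rewrite addr0 -mulrDl => /eqP; rewrite mulf_eq0 (negPf DK) orbF => /eqP.
have Vz : V z by [].
have := is_derive_eq_on oV Vz K1 (is_derive_fctD (Kd z Vz)
     (is_derive_fctD (Kd z Vz) (c _ z))) (c 0 z).
by move=> E; move: DKz; rewrite (_ : 'D_v K z = 0) ?eqxx//; lra.
Qed.

End LocalShrinker.

(** * The flat case with nonzero mean curvature *)

Section LocalCylinder.
Context {R : realType} (U : set 'rV[R]_2).
Context (x n : 'rV[R]_2 -> 'rV[R]_3) (S : 'rV[R]_2 -> 'M[R]_2) (H : R).
Implicit Types z u v w : 'rV[R]_2.
Hypothesis oU : open U.
Hypothesis xs : smooth_on U x.
Hypothesis ns : smooth_on U n.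
Hypothesis inj : forall z v, U z -> 'D_v x z = 0 -> v = 0.
Hypothesis orth : forall z v, U z -> dot ('D_v x z) (n z) = 0.
Hypothesis unit : forall z, U z -> dot (n z) (n z) = 1.
Hypothesis nS : forall z v, U z -> 'D_v n z = - 'D_(v *m S z) x z.
Hypothesis trS : forall z, U z -> \tr (S z) = 2 * H.
Hypothesis H0 : H != 0.
Hypothesis detS0 : forall z, U z -> \det (S z) = 0.
Hypothesis hcst : forall z v, U z -> 'D_v (fun y => dot (n y) (x y)) z = 0.

(** The axis is [e2]: constant [mu] makes the connection coefficients vanish by Codazzi, and [e2]
    has no normal derivative since its curvature is 0. Constancy of h gives [2 H <x, e1> = 0], so
    [x] has only components along [e2] and [n]. *)
Lemma cylinder_axis z0 : U z0 ->
  exists2 u : 'rV[R]_3, dot u u = 1 & \forall z \near z0,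
    [/\ dot (n z) u = 0, (forall v, dot ('D_v n z) u = 0),
        x z - dot (x z) u *: u = dot (n z) (x z) *: n z &
        dot (n z) (x z) != 0].
Proof.
move=> Uz0.
(* Trace [2 H] and determinant 0 mean curvatures [2 H] and 0, that is [mu = H]. *)
have [|_ _|z Uz|V [e1 [e2 [X1 [X2 [VU Vz0 F]]]]]] :=
  @principal_frame_existence R U x n S H oU xs ns inj orth unit nS trS (fun=> H)
    _ _ _ z0 Uz0 => //.
- exact: smooth_on_cst.
- by rewrite detS0// subrr.
have oV := frame_open F.
have Hd z v : is_derive z v (fun _ : 'rV[R]_2 => H) 0 by exact: is_derive_fct_cst.
have H20 : 2 * H != 0 by rewrite mulf_neq0.
have w0 z : V z -> frame_w1 e1 e2 X1 z = 0 /\ frame_w2 e1 e2 X2 z = 0.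
  move=> Vz; have [C1 C2] := frame_codazzi F Vz (Hd _ _) (Hd _ _).
  split; apply/eqP; first by move/eqP: C1; rewrite mulf_eq0 (negPf H20).
  by move/eqP: C2; rewrite oppr0 mulf_eq0 (negPf H20).
have orth' z v : V z -> dot ('D_v x z) (n z) = 0 by move=> /VU; exact: orth.
have e2d z : V z -> differentiable e2 z by exact: smooth_on_differentiable (frame_e2 F).
have e2c z v : V z -> 'D_v e2 z = 0.
  move=> Vz; have [w10 w20] := w0 z Vz.
  apply: (principal_frame_derive0 F orth' v Vz (e2d _ Vz)).
    have [_ ->] := frame_derive_e21 F Vz.
    by rewrite w10 oppr0 scale0r.
  have [_ ->] := frame_derive_e22 F Vz.
  by rewrite w20 subrr oppr0 !scale0r addr0.
have xe1 z : V z -> dot (x z) (e1 z) = 0.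
  move=> Vz; have nd := smooth_on_is_derive (X1 z) (frame_n F) Vz.
  have xd := smooth_on_is_derive (X1 z) (frame_x F) Vz.
  have := hcst (X1 z) (VU _ Vz); have [_ ->] := is_derive_dot nd xd.
  rewrite (frame_Dn1 F Vz) (frame_Dx1 F Vz) dotZl (dotC (e1 z)) (dotC (n z)).
  rewrite (frame_e1n F)// addr0.
  move=> /eqP; rewrite mulf_eq0 oppr_eq0 -mulr2n -mulr_natl (negPf H20).
  by move=> /eqP.
exists (e2 z0); first exact: frame_e22 F _ Vz0.
have e2near := derive0_near_cst_row oV e2d e2c Vz0.
apply: filterS2 e2near (open_nbhs_nbhs (conj oV Vz0)) => z <- Vz.
split => //.
- by rewrite dotC (frame_e2n F).
- move=> v; have [a [b ->]] := principal_frame_span F orth' v Vz.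
  rewrite (derive_comb _ _ _ _ (smooth_on_differentiable (frame_n F) Vz)).
  rewrite (frame_Dn1 F Vz) (frame_Dn2 F Vz) !dotE (frame_e12 F Vz) subrr oppr0.
  by rewrite mul0r !mulr0 addr0.
- rewrite [in X in X - _](principal_frame_expand F (x z) Vz) (xe1 _ Vz).
  by rewrite scale0r add0r addrAC subrr add0r (dotC (x z) (n z)).
(* Differentiating [<x, e1> = 0] along [e1] gives [1 + 2 H h = 0], so h cannot vanish. *)
have xd := smooth_on_is_derive (X1 z) (frame_x F) Vz; rewrite (frame_Dx1 F Vz) in xd.
have := is_derive_eq_on oV Vz xe1 (is_derive_dot xd (frame_derive_e11 F Vz))
  (is_derive_fct_cst 0 z (X1 z)).
have [-> _] := w0 z Vz; rewrite scale0r add0r dotZr (frame_e11 F Vz) (dotC (x z)).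
by move=> E; apply/eqP => h0; move: E; rewrite h0 mulr0 addr0 => /eqP; rewrite oner_eq0.
Qed.

End LocalCylinder.

(** * Charts and principal curvatures *)
Section LinearAlgebra.
Context {R : realType}.

(** Dimension count: both row spaces lie in the plane orthogonal to [w], and that of [A] already has
    rank 2. *)
Lemma orthogonal_complement_submx (A B : 'M[R]_(2, 3)) (w : 'rV[R]_3) :
  row_free A -> w != 0 -> A *m w^T = 0 -> B *m w^T = 0 -> (B <= A)%MS.
Proof.
move=> Af w0 Aw Bw.
have AK : (A <= kermx w^T)%MS by apply/sub_kermxP.
have BK : (B <= kermx w^T)%MS by apply/sub_kermxP.
apply: submx_trans BK _; rewrite -(geq_leqif (mxrank_leqif_sup AK)).
rewrite mxrank_ker mxrank_tr (eqP Af) leq_subLR.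
by move: w0; rewrite -mxrank_eq0; case: (\rank w) => // k _; rewrite addn2.
Qed.

Lemma eigenvalue_det2 (A : 'M[R]_2) a :
  eigenvalue A a = (a ^+ 2 - \tr A * a + \det A == 0).
Proof.
rewrite /eigenvalue /eigenspace kermx_eq0 row_free_unit unitmxE unitfE negbK.
congr (_ == _); rewrite !det2 mxtrace2 !mxE /= !mulr1n !mulr0n; ring.
Qed.

Lemma same_pair (r1 r2 k1 k2 : R) :
  (forall a, (a = r1 \/ a = r2) <-> (a = k1 \/ a = k2)) ->
  k1 + k2 = r1 + r2 /\ k1 * k2 = r1 * r2.
Proof.
move=> rk; have := (rk r1).1 (or_introl erefl); have := (rk r2).1 (or_intror erefl).
have := (rk k1).2 (or_introl erefl); have := (rk k2).2 (or_intror erefl).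
by case=> a; case=> b; case=> c; case=> d; subst; split; rewrite ?d ?c //; lra.
Qed.

(** The hypothesis says that the matrix with rows [(a, b)] and [(c, d)] is self-adjoint for the form
    with coefficients [E, F, G]. Eliminating [c E] turns [E^2] times the discriminant into a sum of
    nonnegative terms. *)
Lemma self_adjoint_discriminant_ge0 (a b c d E F G : R) :
  0 < E -> 0 <= E * G - F ^+ 2 -> a * F + b * G = c * E + d * F ->
  0 <= (a + d) ^+ 2 - 4 * (a * d - b * c).
Proof.
move=> E0 g0 sym; rewrite -(pmulr_rge0 _ (exprn_gt0 2 E0)).
have -> : E ^+ 2 * ((a + d) ^+ 2 - 4 * (a * d - b * c)) =
  ((a - d) * E + 2 * b * F) ^+ 2 + 4 * b ^+ 2 * (E * G - F ^+ 2).
  have -> : E ^+ 2 * ((a + d) ^+ 2 - 4 * (a * d - b * c)) =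
    E ^+ 2 * (a - d) ^+ 2 + 4 * b * E * (c * E + d * F - d * F) by ring.
  by rewrite -sym; ring.
by rewrite addr_ge0 ?sqr_ge0// mulr_ge0// mulr_ge0// sqr_ge0.
Qed.

Lemma gram_ge0 m (A B : 'rV[R]_m) : A != 0 ->
  0 <= dot A A * dot B B - dot A B ^+ 2.
Proof.
move=> A0; rewrite -(pmulr_rge0 _ (dot_gt0 A0)).
have := dot_ge0 (dot A A *: B - dot A B *: A).
by rewrite !dotE (dotC B A); congr (0 <= _); ring.
Qed.

(** Both [u] and [u'] span the line orthogonal to [w] and [n], so [u' = k u] with [k^2 = 1]; the
    sign disappears in [u^T u]. *)
Lemma projection_eq (u u' w n : 'rV[R]_3) : dot u u = 1 -> dot u' u' = 1 ->
  dot n n = 1 -> w != 0 -> dot w n = 0 -> dot n u = 0 -> dot n u' = 0 ->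
  dot w u = 0 -> dot w u' = 0 -> u^T *m u = u'^T *m u'.
Proof.
move=> uu u'u' nn w0 wn nu nu' wu wu'.
have r0 : Num.sqrt (dot w w) != 0 by rewrite gt_eqF// sqrtr_gt0 dot_gt0.
pose e := (Num.sqrt (dot w w))^-1 *: w.
have ee : dot e e = 1.
  by rewrite /e !dotE -{3}[dot w w]sqr_sqrtr ?dot_ge0//; field.
have := @orthonormal_expansion R e u n u' ee uu nn.
rewrite /e !dotE wu wn (dotC u n) nu (dotC u' w) wu' (dotC u' n) nu' !mulr0.
move=> /(_ erefl erefl erefl); rewrite !scale0r add0r addr0 => u'E.
move: u'u' u'E; move: (dot u' u) => k; move=> + u'E; rewrite u'E !dotE uu mulr1 => c1.
by rewrite [(k *: u)^T]linearZ/= -scalemxAl -scalemxAr scalerA c1 scale1r.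
Qed.

Lemma mulmx_projection m (a u : 'rV[R]_m) : a *m (u^T *m u) = dot a u *: u.
Proof. by rewrite mulmxA dot_mulmx mul_scalar_mx. Qed.

End LinearAlgebra.

Section Charts.
Context {R : realType} (Sigma : surface R).
Implicit Types (c : chart R Sigma) (p q : Sigma).

Lemma chart_invK c z : chart_cod c z -> chart_map c (chart_inv c z) = z.
Proof. by move=> [p cp <-]; rewrite chart_mapK. Qed.

Lemma chart_inv_dom c z : chart_cod c z -> chart_dom c (chart_inv c z).
Proof. by move=> [p cp <-]; rewrite chart_mapK. Qed.

Lemma near_chart c p (P : Sigma -> Prop) : chart_dom c p ->
  (\forall z \near chart_map c p, P (chart_inv c z)) -> \forall q \near p, P q.
Proof.
move=> cp zP; have q1 := @chart_map_continuous _ _ c _ cp _ zP.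
have q2 : nbhs p (chart_dom c) by apply: open_nbhs_nbhs; split => //; exact: chart_dom_open.
near=> q; have cq : chart_dom c q by near: q.
by rewrite -(chart_mapK cq); near: q.
Unshelve. all: by end_near.
Qed.

Lemma derive_chart n (f : Sigma -> 'rV[R]_n) c p v : smooth_map f -> atlas c ->
  chart_dom c p -> 'D_v (f \o chart_inv c) (chart_map c p) = v *m dmap f c p.
Proof.
move=> fs Ac cp; apply: deriveEjacobian.
by apply: (smooth_on_differentiable (fs c Ac)); exists p.
Qed.

Lemma dmap_transition n (f : Sigma -> 'rV[R]_n) c c' p :
  smooth_map f -> atlas c -> atlas c' -> chart_dom c p -> chart_dom c' p ->
  dmap f c' p = 'J (transition c' c) (chart_map c' p) *m dmap f c p.
Proof.
move=> fs Ac Ac' cp c'p.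
have [_ /(_ c' c Ac' Ac) Ts] := surface_smooth Sigma.
have Td : differentiable (transition c' c) (chart_map c' p).
  by apply: (smooth_on_differentiable Ts); exists p.
have Tp : transition c' c (chart_map c' p) = chart_map c p.
  by rewrite /transition /= chart_mapK.
have fd : differentiable (f \o chart_inv c) (transition c' c (chart_map c' p)).
  by rewrite Tp; apply: (smooth_on_differentiable (fs c Ac)); exists p.
(* The factorization through the transition map holds only while [chart_inv c'] stays in the domain
   of [c], hence near the point. *)
have zc : \forall z \near chart_map c' p, chart_dom c (chart_inv c' z).
  have cc : chart_cod c' (chart_map c' p) by exists p.
  apply: (@chart_inv_continuous _ _ c' _ cc).
  by rewrite chart_mapK//; apply: open_nbhs_nbhs; split => //; exact: chart_dom_open.
have E : \forall z \near chart_map c' p,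
    ((f \o chart_inv c) \o transition c' c) z = (f \o chart_inv c') z.
  by apply: filterS zc => z cz; rewrite /transition /= chart_mapK.
apply/row_matrixP => i; rewrite !rowE mulmxA -(derive_chart _ fs Ac' c'p).
rewrite -(near_eq_derive _ E) deriveE; last exact: differentiable_comp.
rewrite diff_comp//= -(deriveE _ fd) -(deriveE _ Td).
by rewrite Tp (derive_chart _ fs Ac cp) deriveEjacobian.
Qed.

End Charts.

Lemma row2E (R : realType) (A : 'M[R]_2) (i : 'I_2) :
  row i A = A i 0 *: delta_mx 0 0 + A i 1 *: delta_mx 0 1.
Proof.
apply/rowP => -[[|[|//]] j2]; rewrite !mxE /= ?mulr1 ?mulr0 ?addr0 ?add0r;
  by congr (A _ _); apply/val_inj.
Qed.

Section Immersed.
Context {R : realType} (Sigma : surface R).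
Context (Phi N : Sigma -> 'rV[R]_3).
Hypothesis imm : immersion Phi.
Hypothesis nor : unit_normal Phi N.
Implicit Types (c : chart R Sigma) (p q : Sigma).

Let Phis : smooth_map Phi. Proof. by case: imm. Qed.
Let Ns : smooth_map N. Proof. by case: nor. Qed.

Lemma unit_normal_dot p : dot (N p) (N p) = 1.
Proof.
case: nor => _ /(_ p) N1 _.
by rewrite -(sqr_sqrtr (dot_ge0 (N p))) -/(enorm (N p)) N1 expr1n.
Qed.

Section InChart.
Variable c : chart R Sigma.
Hypothesis Ac : atlas c.
Local Notation U := (chart_cod c).
Local Notation x := (Phi \o chart_inv c).
Local Notation n := (N \o chart_inv c).
Implicit Types z v : 'rV[R]_2.

Definition chart_shape z := shape_operator Phi N c (chart_inv c z).
Local Notation S := chart_shape.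

Let oU : open U. Proof. exact: chart_cod_open. Qed.
Let xs : smooth_on U x. Proof. exact: Phis. Qed.
Let ns : smooth_on U n. Proof. exact: Ns. Qed.

Lemma derive_chart_inv m (f : Sigma -> 'rV[R]_m) z v : smooth_map f -> U z ->
  'D_v (f \o chart_inv c) z = v *m dmap f c (chart_inv c z).
Proof.
move=> fs Uz; have := derive_chart v fs Ac (chart_inv_dom Uz).
by rewrite chart_invK.
Qed.

Lemma chart_immersion_inj z v : U z -> 'D_v x z = 0 -> v = 0.
Proof.
move=> Uz; rewrite derive_chart_inv// => /eqP.
have [_ /(_ c _ Ac (chart_inv_dom Uz)) f] := imm.
by rewrite mulmx_free_eq0// => /eqP.
Qed.

Lemma chart_orthogonal z v : U z -> dot ('D_v x z) (n z) = 0.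
Proof.
move=> Uz; rewrite derive_chart_inv//; case: nor => _ _ /(_ c _ Ac).
by move=> /(_ _ (chart_inv_dom Uz)); exact.
Qed.

Lemma chart_unit z : U z -> dot (n z) (n z) = 1.
Proof. by move=> _; exact: unit_normal_dot. Qed.

Lemma chart_derive_normal_orthogonal z v : U z -> dot ('D_v n z) (n z) = 0.
Proof.
move=> Uz; have nd := smooth_on_is_derive v ns Uz.
have := is_derive_eq_on oU Uz chart_unit (is_derive_dot nd nd)
  (is_derive_fct_cst (1 : R) z v).
by rewrite (dotC (n z)) -mulr2n => /eqP; rewrite mulrn_eq0 => /eqP.
Qed.

Lemma chart_shapeE z v : U z -> 'D_v n z = - 'D_(v *m S z) x z.
Proof.
move=> Uz; suff SE : dmap N c (chart_inv c z) =
    - (S z *m dmap Phi c (chart_inv c z)).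
  rewrite (derive_chart_inv _ Ns Uz) (derive_chart_inv _ Phis Uz) SE.
  by rewrite mulmxN mulmxA.
suff le : (dmap N c (chart_inv c z) <= dmap Phi c (chart_inv c z))%MS.
  by rewrite /chart_shape /shape_operator mulNmx opprK (mulmxKpV le).
have cz := chart_inv_dom Uz.
have orthN (A : 'M[R]_(2, 3)) : (forall v, dot (v *m A) (N (chart_inv c z)) = 0) ->
    A *m (N (chart_inv c z))^T = 0.
  move=> A0; apply/row_matrixP => i; rewrite row0 row_mul dot_mulmx rowE.
  by rewrite A0 raddf0.
apply: (orthogonal_complement_submx (w := N (chart_inv c z))).
- by have [_ /(_ c _ Ac cz)] := imm.
- by rewrite -dot_eq0 unit_normal_dot oner_eq0.
- by apply: orthN => w; rewrite -derive_chart_inv//; exact: chart_orthogonal.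
- apply: orthN => w; rewrite -derive_chart_inv//.
  exact: chart_derive_normal_orthogonal.
Qed.

(** The shape operator is self-adjoint for the first fundamental form, so its characteristic
    polynomial has nonnegative discriminant. *)
Lemma chart_shape_real_roots z : U z ->
  exists k : R * R, k.1 + k.2 = \tr (S z) /\ k.1 * k.2 = \det (S z).
Proof.
move=> Uz; have xd := smooth_on_differentiable xs Uz.
pose A := 'D_(delta_mx 0 0) x z; pose B := 'D_(delta_mx 0 1) x z.
have A0 : A != 0.
  apply/eqP => /(chart_immersion_inj Uz)/rowP/(_ 0)/eqP.
  by rewrite !mxE oner_eq0.
have sym : S z 0 0 * dot A B + S z 0 1 * dot B B =
           S z 1 0 * dot A A + S z 1 1 * dot A B.
  have rowS i : 'D_(delta_mx 0 i *m S z) x z = S z i 0 *: A + S z i 1 *: B.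
    rewrite -(derive_comb _ _ _ _ xd); congr ('D_ _ _ _); rewrite -rowE.
    exact: row2E.
  have := shape_self_adjoint oU xs ns chart_orthogonal chart_shapeE
    (delta_mx 0 0) (delta_mx 0 1) 0 Uz.
  rewrite (_ : 0%:M = 0) ?subr0; last by apply/matrixP => i j; rewrite !mxE mul0rn.
  rewrite (rowS 0) (rowS 1).
  have alg (a b c' d : R) (e f : 'rV[R]_3) :
      dot (a *: e + b *: f) f = dot e (c' *: e + d *: f) ->
      a * dot e f + b * dot f f = c' * dot e e + d * dot e f by rewrite !dotE.
  exact: alg.
have disc := self_adjoint_discriminant_ge0 (dot_gt0 A0) (gram_ge0 B A0) sym.
rewrite mxtrace2 det2; set D := (X in 0 <= X) in disc.
exists ((S z 0 0 + S z 1 1 + Num.sqrt D) / 2, (S z 0 0 + S z 1 1 - Num.sqrt D) / 2).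
split=> /=; first by field.
have := sqr_sqrtr disc; move: (Num.sqrt D) => r rD.
transitivity (((S z 0 0 + S z 1 1) ^+ 2 - r ^+ 2) / 4); first by field.
by rewrite rD /D; field.
Qed.

End InChart.

(** Stating the eigenvector equation as [dN v = - a dPhi v] makes it visibly invariant under a
    change of chart. *)
Lemma shape_eigenvalue c p a : atlas c -> chart_dom c p ->
  eigenvalue (shape_operator Phi N c p) a <->
  exists2 v : 'rV[R]_2, v != 0 & v *m dmap N c p = - a *: (v *m dmap Phi c p).
Proof.
move=> Ac cp; have [_ /(_ c p Ac cp) f] := imm.
have SE (v : 'rV[R]_2) : v *m shape_operator Phi N c p *m dmap Phi c p = - (v *m dmap N c p).
  have Uz : chart_cod c (chart_map c p) by exists p.
  have := etrans (esym (derive_chart v Ns Ac cp)) (chart_shapeE Ac v Uz).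
  rewrite (derive_chart _ Phis Ac cp) /chart_shape (chart_mapK cp) => ->.
  by rewrite opprK.
split=> [/eigenvalueP[v vS v0]|[v v0 vE]].
  exists v => //; apply: oppr_inj; rewrite -SE vS.
  by rewrite scaleNr opprK scalemxAl.
apply/eigenvalueP; exists v => //.
apply: (row_free_inj f); rewrite /= SE vE scaleNr opprK.
by rewrite scalemxAl.
Qed.

Lemma shape_eigenvalue_chart c c' p a : atlas c -> atlas c' ->
  chart_dom c p -> chart_dom c' p ->
  eigenvalue (shape_operator Phi N c' p) a -> eigenvalue (shape_operator Phi N c p) a.
Proof.
move=> Ac Ac' cp c'p /(shape_eigenvalue a Ac' c'p)[v v0 vE].
apply/(shape_eigenvalue a Ac cp).
exists (v *m 'J (transition c' c) (chart_map c' p)).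
  apply: contra_neq v0 => vJ; have [_ /(_ c' p Ac' c'p) f] := imm.
  apply/eqP; rewrite -(mulmx_free_eq0 _ f) (dmap_transition Phis Ac Ac' cp c'p).
  by rewrite mulmxA vJ mul0mx.
have E (f : Sigma -> 'rV[R]_3) : smooth_map f -> v *m
    'J (transition c' c) (chart_map c' p) *m dmap f c p = v *m dmap f c' p.
  by move=> fs; rewrite (dmap_transition fs Ac Ac' cp c'p) mulmxA.
exact: etrans (E N Ns) (etrans vE (congr1 (fun w => - a *: w) (esym (E Phi Phis)))).
Qed.

(** The chosen pair is fixed only up to order, but its sum and product are symmetric. The default
    value of [xget] is excluded by exhibiting the pair [k]. *)
Lemma principal_curvaturesE c p : atlas c -> chart_dom c p ->
  2 * mean_curvature Phi N p = \tr (shape_operator Phi N c p) /\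
  gauss_curvature Phi N p = \det (shape_operator Phi N c p).
Proof.
move=> Ac cp; have Uz : chart_cod c (chart_map c p) by exists p.
have [k []] := chart_shape_real_roots Ac Uz; rewrite /chart_shape chart_mapK//.
move=> kt kd.
have ek a : eigenvalue (shape_operator Phi N c p) a <-> a = k.1 \/ a = k.2.
  rewrite eigenvalue_det2 -kt -kd.
  rewrite (_ : _ + _ = (a - k.1) * (a - k.2)); last by ring.
  rewrite mulf_eq0 !subr_eq0; split=> [/orP[]/eqP|[]->]; rewrite ?eqxx ?orbT//.
    by left.
  by right.
have kP : are_principal_curvatures Phi N p k.
  move=> c' Ac' c'p a; rewrite -ek.
  by split; exact: shape_eigenvalue_chart.
have := @xgetPex _ (0, 0) [set k | are_principal_curvatures Phi N p k] (ex_intro _ k kP).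
rewrite -/(principal_curvatures Phi N p) /= => gP.
have [sE pE] := @same_pair R k.1 k.2 (principal_curvatures Phi N p).1
  (principal_curvatures Phi N p).2 (fun a => iff_trans (iff_sym (ek a)) (gP c Ac cp a)).
by rewrite /mean_curvature /gauss_curvature -kt -kd -sE -pE; split => //; field.
Qed.

Lemma exists_chart p : exists2 c, atlas c & chart_dom c p.
Proof. by have [/(_ p)] := surface_smooth Sigma. Qed.

(** Makes [H^2 - K] a legitimate radicand for [mu]. *)
Lemma gauss_curvature_le p : gauss_curvature Phi N p <= mean_curvature Phi N p ^+ 2.
Proof.
rewrite /gauss_curvature /mean_curvature.
move: (principal_curvatures Phi N p).1 (principal_curvatures Phi N p).2 => a b.
by rewrite -subr_ge0 (_ : _ - _ = ((a - b) / 2) ^+ 2) ?sqr_ge0//; field.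
Qed.

End Immersed.

(** * Classification *)
Section ShrinkerClassification.
Context {R : realType} (Sigma : surface R).
Context (Phi N : Sigma -> 'rV[R]_3) (la al H : R).
Hypothesis al0 : al != 0.
Hypothesis imm : immersion Phi.
Hypothesis nor : unit_normal Phi N.
Hypothesis shr : gauss_flow_shrinker la al Phi N.
Hypothesis HC : forall p, mean_curvature Phi N p = H.
Implicit Types (c : chart R Sigma) (p q : Sigma).

Let Phis : smooth_map Phi. Proof. by case: imm. Qed.
Let Ns : smooth_map N. Proof. by case: nor. Qed.

Let locally_constant (W : Type) (f : Sigma -> W) :
  (forall c z, atlas c -> chart_cod c z -> \forall y \near z,
     f (chart_inv c y) = f (chart_inv c z)) -> forall p q, f p = f q.
Proof.
move=> fc; apply: near_cst_connected; first exact: surface_connected.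
move=> p; have [c Ac cp] := exists_chart p.
have Uz : chart_cod c (chart_map c p) by exists p.
apply: (near_chart (P := fun q => f q = f p) cp).
by have := fc c _ Ac Uz; rewrite chart_mapK.
Qed.

Section InChart.
Variable c : chart R Sigma.
Hypothesis Ac : atlas c.
Local Notation U := (chart_cod c).
Local Notation x := (Phi \o chart_inv c).
Local Notation n := (N \o chart_inv c).
Local Notation S := (chart_shape Phi N c).
Implicit Types z v : 'rV[R]_2.

Let oU : open U. Proof. exact: chart_cod_open. Qed.
Let xs : smooth_on U x. Proof. exact: Phis. Qed.
Let ns : smooth_on U n. Proof. exact: Ns. Qed.

Lemma chart_shape_trace z : U z -> \tr (S z) = 2 * H.
Proof.
move=> Uz; have [<- _] := principal_curvaturesE imm nor Ac (chart_inv_dom Uz).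
by rewrite HC.
Qed.

Lemma chart_shape_det z : U z -> \det (S z) = gauss_curvature Phi N (chart_inv c z).
Proof.
by move=> Uz; have [_ <-] := principal_curvaturesE imm nor Ac (chart_inv_dom Uz).
Qed.

Lemma chart_support_derive0 z v : U z -> 'D_v (fun y => dot (n y) (x y)) z = 0.
Proof.
have shrz y : U y -> \det (S y) = al * dot (n y) (x y) + la.
  by move=> Uy; rewrite chart_shape_det//; exact: shr.
have lez y : U y -> \det (S y) <= H ^+ 2.
  move=> Uy; rewrite chart_shape_det// -(HC (chart_inv c y)).
  exact: gauss_curvature_le.
exact: (@shrinker_support_derive0 R U x n S H al la oU xs ns
  (chart_immersion_inj imm Ac) (chart_orthogonal imm nor Ac) (chart_unit nor (c := c))
  (chart_shapeE imm nor Ac) chart_shape_trace al0 shrz lez).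
Qed.

Lemma chart_normal_tangent z v : U z -> dot ('D_v n z) (x z) = 0.
Proof.
move=> Uz; have nd := smooth_on_is_derive v ns Uz.
have xd := smooth_on_is_derive v xs Uz.
have := chart_support_derive0 v Uz; have [_ ->] := is_derive_dot nd xd.
by rewrite (dotC (n z)) (chart_orthogonal imm nor Ac)// addr0.
Qed.

(** For invertible [S], each [D_v x] is a value of dN, namely [- D_(v S^-1) n], hence orthogonal to
    [x]. *)
Lemma chart_sphere_near_cst z : (forall y, U y -> \det (S y) != 0) -> U z ->
  \forall y \near z, dot (x y) (x y) = dot (x z) (x z).
Proof.
move=> det0; apply: (derive0_near_cst oU).
  move=> y Uy; apply: smooth_on_differentiable Uy.
  exact: smooth_on_dot.
move=> y v Uy; have xd := smooth_on_is_derive v xs Uy.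
have [_ ->] := is_derive_dot xd xd.
rewrite (dotC (x y)).
have SU : S y \in unitmx by rewrite unitmxE unitfE det0.
have := chart_normal_tangent (v *m invmx (S y)) Uy.
rewrite (chart_shapeE imm nor Ac)// mulmxKV// dotNl => /eqP.
by rewrite oppr_eq0 => /eqP ->; rewrite addr0.
Qed.

(** Trace and determinant 0 give [S^2 = 0]; self-adjointness then makes [|D_v n|^2] equal to
    [- <D_(v S) n, D_v x> = 0]. *)
Lemma chart_flat_normal z v : H = 0 -> U z -> \det (S z) = 0 -> 'D_v n z = 0.
Proof.
move=> H0 Uz d0; apply/eqP; rewrite -dot_eq0; apply/eqP.
have S2 : S z *m S z = 0.
  have := @cayley_hamilton2 R (S z) 0 0.
  rewrite (_ : 0%:M = 0) ?subr0; last by apply/matrixP => i j; rewrite !mxE mul0rn.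
  apply; first by rewrite chart_shape_trace// H0 mulr0 addr0.
  by rewrite d0 mulr0.
have E := normal_self_adjoint oU xs ns (chart_orthogonal imm nor Ac) v (v *m S z) Uz.
have nE := chart_shapeE imm nor Ac.
have vSS : 'D_(v *m S z) n z = 0.
  by rewrite (nE z (v *m S z) Uz) -mulmxA S2 mulmx0 derive0 oppr0.
rewrite [X in dot _ X](nE z v Uz) dotNr E vSS dot0l oppr0.
by [].
Qed.

End InChart.

Let support_cst p q : dot (N p) (Phi p) = dot (N q) (Phi q).
Proof.
apply: (locally_constant (f := fun p => dot (N p) (Phi p))) => c z Ac Uz.
have oU : open (chart_cod c) by exact: chart_cod_open.
apply: (@derive0_near_cst _ _ (chart_cod c)
  (fun y => dot (N (chart_inv c y)) (Phi (chart_inv c y)))) => //.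
  move=> y Uy; apply: smooth_on_differentiable Uy.
  by apply: smooth_on_dot => //; [exact: Ns|exact: Phis].
by move=> y v Uy; exact: (chart_support_derive0 Ac v Uy).
Qed.

Let curvature_cst p q : gauss_curvature Phi N p = gauss_curvature Phi N q.
Proof. by rewrite !shr (support_cst p q). Qed.

Variable p0 : Sigma.

Let Phi_nonconstant c z : atlas c -> chart_cod c z ->
  exists v, 'D_v (Phi \o chart_inv c) z != 0.
Proof.
move=> Ac Uz; exists (delta_mx 0 0); apply/eqP => D0.
have /rowP/(_ 0)/eqP := chart_immersion_inj imm Ac Uz D0.
by rewrite !mxE oner_eq0.
Qed.

Lemma shrinker_sphere : gauss_curvature Phi N p0 != 0 ->
  exists2 P : set 'rV[R]_3, is_sphere P & range Phi `<=` P.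
Proof.
move=> K0.
have cst p q : dot (Phi p) (Phi p) = dot (Phi q) (Phi q).
  apply: (locally_constant (f := fun p => dot (Phi p) (Phi p))) => c z Ac Uz.
  apply: (chart_sphere_near_cst Ac) => // y Uy.
  by rewrite chart_shape_det// (curvature_cst _ p0).
exists [set y | enorm (y - 0) = enorm (Phi p0)].
  exists 0, (enorm (Phi p0)); split=> //; rewrite sqrtr_gt0 lt_def dot_ge0 andbT.
  apply/eqP => P0.
  (* Radius 0 would make [Phi] identically zero, which an immersion cannot be. *)
  have Phi0 p : Phi p = 0 by apply/eqP; rewrite -dot_eq0 (cst p p0) P0.
  have [c Ac cp] := exists_chart p0.
  have Uz : chart_cod c (chart_map c p0) by exists p0.
  have [v /eqP] := Phi_nonconstant Ac Uz; apply.
  rewrite (_ : Phi \o chart_inv c = fun=> 0) ?derive_cst//.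
  by apply/funext => y /=.
by move=> _ [p _ <-] /=; rewrite subr0 /enorm (cst p p0).
Qed.

Lemma shrinker_plane : gauss_curvature Phi N p0 = 0 -> H = 0 ->
  exists2 P : set 'rV[R]_3, is_plane P & range Phi `<=` P.
Proof.
move=> K0 H0.
have cst p q : N p = N q.
  apply: locally_constant => c z Ac Uz.
  apply: (@derive0_near_cst_row _ _ _ (chart_cod c) (N \o chart_inv c)) => //.
  - exact: chart_cod_open.
  - by move=> y Uy; apply: smooth_on_differentiable Uy; exact: Ns.
  move=> y v Uy; apply: (chart_flat_normal Ac) => //.
  by rewrite chart_shape_det// (curvature_cst _ p0).
exists [set y | dot y (N p0) = dot (N p0) (Phi p0)].
  exists (N p0), (dot (N p0) (Phi p0)); split=> //.
  by rewrite -dot_eq0 (unit_normal_dot nor) oner_eq0.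
by move=> _ [p _ <-] /=; rewrite dotC -{1}(cst p) (support_cst p p0).
Qed.

(** The third clause ranges over all charts at [p], which makes the property independent of the
    chart where the axis was found. *)
Let is_axis (u : 'rV[R]_3) p :=
  [/\ dot u u = 1, dot (N p) u = 0,
    (forall c, atlas c -> chart_dom c p -> forall v, dot (v *m dmap N c p) u = 0),
    Phi p - dot (Phi p) u *: u = dot (N p) (Phi p) *: N p &
    dot (N p) (Phi p) != 0].

(** As [tr S = 2 H] is nonzero, some value [w] of dN is nonzero; an axis is orthogonal to both [w]
    and [N]. *)
Let axis_unique u u' p : H != 0 -> is_axis u p -> is_axis u' p ->
  u^T *m u = u'^T *m u'.
Proof.
move=> H0 [uu nu du _ _] [u'u' nu' du' _ _].
have [c Ac cp] := exists_chart p.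
have Uz : chart_cod c (chart_map c p) by exists p.
have S0 : chart_shape Phi N c (chart_map c p) != 0.
  apply/eqP => S0; have := chart_shape_trace Ac Uz; rewrite S0 raddf0.
  by move=> /esym/eqP; rewrite mulf_eq0 (negPf H0) orbF pnatr_eq0.
have [v vS] := mx_neq0_mulmx S0.
have nd w := derive_chart w Ns Ac cp.
apply: (projection_eq (w := v *m dmap N c p) (n := N p)) => //.
- exact: unit_normal_dot nor p.
- apply: contra_neq vS => v0; apply: (chart_immersion_inj imm Ac Uz).
  apply: oppr_inj; rewrite oppr0 -(chart_shapeE imm nor Ac v Uz).
  exact: etrans (nd v) v0.
- have := chart_derive_normal_orthogonal nor Ac v Uz.
  by rewrite (nd v) /= (chart_mapK cp).
- exact: du.
- exact: du'.
Qed.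

Let axis_near p : gauss_curvature Phi N p0 = 0 -> H != 0 ->
  exists u, \forall q \near p, is_axis u q.
Proof.
move=> K0 H0; have [c Ac cp] := exists_chart p.
have Uz : chart_cod c (chart_map c p) by exists p.
have oU : open (chart_cod c) by exact: chart_cod_open.
have [u uu un] := @cylinder_axis R (chart_cod c) (Phi \o chart_inv c)
  (N \o chart_inv c) (chart_shape Phi N c) H oU (Phis Ac) (Ns Ac)
  (chart_immersion_inj imm Ac) (chart_orthogonal imm nor Ac) (chart_unit nor (c := c))
  (chart_shapeE imm nor Ac) (chart_shape_trace Ac) H0
  (fun z Uz => etrans (chart_shape_det Ac Uz) (etrans (curvature_cst _ p0) K0))
  (fun z v => chart_support_derive0 Ac v) (chart_map c p) Uz.
exists u; apply: (near_chart (P := is_axis u) cp).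
apply: filterS2 un (open_nbhs_nbhs (conj oU Uz)) => z [nu du xE h0] Uz'.
split=> // c' Ac' c'q v.
rewrite (dmap_transition Ns Ac Ac' (chart_inv_dom Uz') c'q) mulmxA.
by rewrite -(derive_chart_inv Ac _ Ns Uz').
Qed.

Lemma shrinker_cylinder : gauss_curvature Phi N p0 = 0 -> H != 0 ->
  exists2 P : set 'rV[R]_3, is_circular_cylinder P & range Phi `<=` P.
Proof.
move=> K0 H0.
have ax p : exists u, is_axis u p.
  by have [u /nbhs_singleton up] := axis_near p K0 H0; exists u.
pose a p := sval (cid (ax p)).
have aP p : is_axis (a p) p by rewrite /a; case: cid.
(* The vectors [a p] are chosen independently and may jump in sign, while their projections agree
   with those of one common axis near each point. *)
have cst p q : (a p)^T *m a p = (a q)^T *m a q.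
  apply: (near_cst_connected (f := fun p => (a p)^T *m a p)).
    exact: surface_connected.
  move=> r; have [u un] := axis_near r K0 H0.
  have ur : is_axis u r := nbhs_singleton un.
  apply: filterS un => s us.
  by rewrite (axis_unique H0 (aP s) us) (axis_unique H0 ur (aP r)).
pose h := dot (N p0) (Phi p0).
have [a0 _ _ _ h0] := aP p0.
exists [set y | enorm ((y - 0) - dot (y - 0) (a p0) *: a p0) = `|h|].
  exists 0, (a p0), `|h|; split=> //; last by rewrite normr_gt0.
  by rewrite /enorm a0 sqrtr1.
move=> _ [p _ <-] /=; have [_ _ _ E _] := aP p.
rewrite !subr0 -mulmx_projection -(cst p) mulmx_projection E (support_cst p p0).
rewrite -/h /enorm dotZl dotZr (unit_normal_dot nor) mulr1 -expr2.
exact: sqrtr_sqr.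
Qed.

End ShrinkerClassification.

Theorem theorem1p2 (R : realType) (lambda alpha : R) (Sigma : surface R)
    (Phi N : Sigma -> 'rV[R]_3)
    (alpha_neq0 : alpha != 0)
    (Phi_immersion : immersion Phi)
    (N_unit_normal : unit_normal Phi N)
    (Phi_shrinker : gauss_flow_shrinker lambda alpha Phi N)
    (H_constant : exists h : R, forall p, mean_curvature Phi N p = h) :
  exists2 P : set 'rV[R]_3,
    is_plane P \/ is_sphere P \/ is_circular_cylinder P &
    range Phi `<=` P.
Proof.
case: H_constant => h hC.
(* The empty space counts as connected here; its empty image lies in any plane. *)
have [[p0 _]|noP] := pselect (exists p : Sigma, True); last first.
  exists [set y | dot y (const_mx 1) = 0].
    left; exists (const_mx 1), 0; split=> //.
    by apply/eqP => /rowP/(_ 0)/eqP; rewrite !mxE oner_eq0.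
  by move=> _ [p _ <-]; case: noP; exists p.
have [K0|K0] := eqVneq (gauss_curvature Phi N p0) 0; last first.
  have [P Ps PhiP] := shrinker_sphere alpha_neq0 Phi_immersion N_unit_normal
    Phi_shrinker hC K0.
  by exists P => //; right; left.
have [h0|h0] := eqVneq h 0.
  have [P Pp PhiP] := shrinker_plane alpha_neq0 Phi_immersion N_unit_normal
    Phi_shrinker hC K0 h0.
  by exists P => //; left.
have [P Pc PhiP] := shrinker_cylinder alpha_neq0 Phi_immersion N_unit_normal
  Phi_shrinker hC K0 h0.
by exists P => //; right; right.
Qed.
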